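(* Let $c\in(0,1]$ and let $n=n(p)$ be a function of $p$ with $n\ge p$ such that $p/n\to c$ as $p\to\infty$. Let $\mathbf{X}$ be the $p\times n$ random rectangular circulant matrix (defined in the context), and let $\lambda_p$ be the smallest eigenvalue of $\mathbf{S}=\frac1n\mathbf{X}\mathbf{X}^\top$. (i) Let $m\ge2$ be a fixed integer and let $\delta\in(0,1)$ be a fixed (arbitrarily small) real number. If $c\le\frac{1-\delta}{m}$, or equivalently $\lim n/p\ge m/(1-\delta)$, then for any (arbitrarily small) $\epsilon>0$, $$\Pr\left\{\lambda_p>p^{-\frac12-\frac1{2m}-\epsilon}\right\}\to1\quad\text{as }p\to\infty .$$ (ii) If $c\in[1/2,1]$, then for any (arbitrarily small) $\epsilon>0$, $$\Pr\left\{\lambda_p>p^{-1-\epsilon}\right\}\to1\quad\text{as }p\to\infty .$$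
   Context: Let $x_i$, $i\in\mathbb{Z}$, be i.i.d. standard normal real random variables. For $n\ge p$, the random rectangular circulant matrix is the $p\times n$ matrix $\mathbf{X}=(x_{(j-i)\bmod n})_{1\le i\le p,\,1\le j\le n}$, where $(j-i)\bmod n\in\{0,\dots,n-1\}$ (so its first row is $(x_0,x_1,\dots,x_{n-1})$ and each subsequent row is the cyclic right shift of the previous one). *)

(* Defs.v *)
From HB Require Import structures.
From mathcomp Require Import all_boot all_order all_algebra.
From mathcomp Require Import all_classical all_reals all_analysis.

Set Implicit Arguments.
Unset Strict Implicit.
Unset Printing Implicit Defensive.

Import Order.TTheory GRing.Theory Num.Theory.
Import numFieldNormedType.Exports.

Local Open Scope classical_set_scope.
Local Open Scope ring_scope.

Definition mutually_independent d (T : measurableType d) (R : realType)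
    (P : probability T R) (I : choiceType) (X : I -> {RV P >-> R}) : Prop :=
  forall (s : seq I) (A : I -> set R),
    uniq s -> (forall i, i \in s -> measurable (A i)) ->
    P (\bigcap_(i in [set` s]) (X i @^-1` A i)) =
    (\prod_(i <- s) P (X i @^-1` A i))%E.

Definition standard_normal d (T : measurableType d) (R : realType)
    (P : probability T R) (X : {RV P >-> R}) : Prop :=
  forall A : set R, measurable A -> distribution P X A = normal_prob 0 1 A.

(* The ordinals i, j start at 0 rather than 1, which leaves j - i unchanged;
   [%%] is the integer remainder, with values in {0, ..., n - 1} for 0 < n. *)
Definition rect_circulant (K : Type) (p n : nat) (a : int -> K) : 'M[K]_(p, n) :=
  \matrix_(i < p, j < n) a ((j%:Z - i%:Z) %% n%:Z)%Z.

Definition sample_covariance (K : fieldType) (p n : nat) (X : 'M[K]_(p, n)) : 'M[K]_p :=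
  n%:R^-1 *: (X *m X^T).

(* The default value 0 is used only if A has no eigenvalue in R; this never
   happens for a symmetric matrix of positive size. *)
Definition smallest_eigenvalue (R : realType) (p : nat) (A : 'M[R]_p) : R :=
  xget 0 [set a | eigenvalue A a /\ forall b, eigenvalue A b -> a <= b].

(* Main.v *)
Require Import Defs.
From HB Require Import structures.
From mathcomp Require Import all_boot all_order all_algebra.
From mathcomp Require Import all_classical all_reals all_analysis.
From mathcomp Require Import measurable_realfun ring lra.

Set Implicit Arguments.
Unset Strict Implicit.
Unset Printing Implicit Defensive.

Import Order.TTheory GRing.Theory Num.Theory.
Import numFieldNormedType.Exports.

Local Open Scope classical_set_scope.
Local Open Scope ring_scope.

(** Let n be the number of columns, cas = cos + sin, and let
H_k(a) = sum_i a_i cas (2 pi k i / n) be the Hartley transform of a. Multiplying a row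
vector v of length p by the circulant matrix is a cyclic convolution of v with the
sample x, so
  n |v X|^2 = sum_k w_k H_k(v)^2   with  w_k = (H_k(x)^2 + H_(-k)(x)^2) / 2,
whereas sum_k H_k(v)^2 = n |v|^2 ([cyclic_conv_energy], [parseval_hartley]). The smallest eigenvalue
is the minimum of |v X|^2 / (n |v|^2), so it can only be small if some v concentrates its
spectrum on the set W of weak frequencies, those with w_k < n tau ([form_ge_weak]).
As the kernel cas is orthogonal, the H_k(x) / sqrt n are independent standard normal.
Thus a frequency k <> -k is weak with probability O(tau), and two of them (not opposite)
are both weak with probability O(tau^2); the at most two frequencies with k = -k are weak
with probability O(sqrt tau).

In part (ii) take tau = p^(-1 - eps/2). The expected number of weak frequencies tends
to 0, and if there are none the smallest eigenvalue is at least tau.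

In part (i) take tau = p^(-1/2 - eps/2). Now W is not empty, but a vector with
only p coordinates cannot live on it: by a large sieve inequality ([large_sieve])
  sum_(k in W) H_k(v)^2 <= (2 p + F) |v|^2,
where F^2 is the sum of the squares of the inner products
G_kl = sum_(i < p) cas (2 pi k i / n) cas (2 pi l i / n) over the k, l in W with l <> k, -k.
All the G_kl^2 together sum to p n^2 ([sum_sqr_gram]), so the mean of F^2 is
O(tau^2 p n^2) = o(n^2). Since m >= 2, the hypothesis on c gives
2 p <= (1 - delta + o(1)) n, so a fixed proportion of the spectral mass n |v|^2 lies on
strong frequencies and the smallest eigenvalue is at least a constant times tau. This
is eventually larger than p^(-1/2 - 1/(2m) - eps).

The events that frequencies are weak enter only through the majorants
exp (1 - (H_k(x)^2 + H_(-k)(x)^2) / (2 n tau)) of their indicators, so the only fact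
needed about the normal law is that the mean of a product of exp (- Y^2 / (2 tau)) over
orthonormal linear forms Y of the sample is at most sqrt tau per form
([integral_weights_le]). Writing each factor as the mean of cos (g Y / sqrt tau) for a
standard normal g reduces this, by Fubini, to the characteristic function of linear
forms ([charfun_lincomb]). The smallest eigenvalue is compared with the quadratic form by
the variational principle ([le_smallest_eigenvalue]), which also makes the events
measurable, as it suffices to test rational vectors. *)

(** * The Hartley kernel *)

Section Hartley.
Variables (R : realType) (n' : nat).
Let n := n'.+1.
Implicit Types (k l : 'I_n) (i j : nat).

Definition ang i j : R := (i * j)%:R * (2 * pi / n'.+1%:R).

(** The Hartley kernel. Unlike the complex exponential it is real, and the matrix
of its values is symmetric and orthogonal up to the factor sqrt n, so that it
turns independent standard normal variables into independent normal ones. *)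
Definition cas i j : R := cos (ang i j) + sin (ang i j).

Lemma angC i j : ang i j = ang j i.
Proof. by rewrite /ang mulnC. Qed.

Lemma angD i j1 j2 : ang i (j1 + j2) = ang i j1 + ang i j2.
Proof. by rewrite /ang mulnDr natrD mulrDl. Qed.

(** Angles depend on a residue class only up to full turns. This makes the
frequencies and positions elements of the ring 'I_n'.+1 of integers modulo n. *)
Lemma ang_mod i j : ang i j = ang i (j %% n'.+1) + pi *+ 2 *+ (i * (j %/ n'.+1)).
Proof.
rewrite {1}(divn_eq j n'.+1) addnC angD; congr (_ + _).
rewrite /ang mulnA natrM -[RHS]mulr_natr -[pi *+ 2]mulr_natr.
have : n'.+1%:R != 0 :> R by rewrite pnatr_eq0.
by move=> ?; field.
Qed.

Lemma cos_ang_mod i j : cos (ang i (j %% n'.+1)) = cos (ang i j).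
Proof. by rewrite [in RHS]ang_mod (periodicn (@cosD2pi R)). Qed.

Lemma sin_ang_mod i j : sin (ang i (j %% n'.+1)) = sin (ang i j).
Proof. by rewrite [in RHS]ang_mod (periodicn (@sinD2pi R)). Qed.

Lemma ang_opp i k :
  ang i (n'.+1 - k) = - ang i k + pi *+ 2 *+ i.
Proof.
have kn : (k <= n'.+1)%N by exact: ltnW.
apply: (@addIr _ (ang i k)); rewrite -angD subnK// addrAC addNr add0r.
rewrite /ang natrM -[RHS]mulr_natr -[pi *+ 2]mulr_natr.
have : n'.+1%:R != 0 :> R by rewrite pnatr_eq0.
by move=> ?; field.
Qed.

Lemma cos_ang_opp i k : cos (ang i (- k)) = cos (ang i k).
Proof. by rewrite cos_ang_mod ang_opp (periodicn (@cosD2pi R)) cosN. Qed.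

Lemma sin_ang_opp i k : sin (ang i (- k)) = - sin (ang i k).
Proof. by rewrite sin_ang_mod ang_opp (periodicn (@sinD2pi R)) sinN. Qed.

Lemma casC i j : cas i j = cas j i.
Proof. by rewrite /cas angC. Qed.

Lemma cas_opp k i : cas (- k) i = cos (ang k i) - sin (ang k i).
Proof. by rewrite /cas ![ang _ i]angC cos_ang_opp sin_ang_opp. Qed.

Lemma sqr_cas_opp k i : cas k i ^+ 2 + cas (- k) i ^+ 2 = 2.
Proof.
rewrite cas_opp /cas; have := cos2Dsin2 (ang k i).
set c := cos _; set s := sin _ => h.
have -> : (c + s) ^+ 2 + (c - s) ^+ 2 = 2 * (c ^+ 2 + s ^+ 2) by ring.
by rewrite h mulr1.
Qed.

(** The reflection k -> -k of the summation index changes the sign of the sum. *)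
Lemma sum_sin_ang i : \sum_(k < n'.+1) sin (ang i k) = 0.
Proof.
set s := \sum_ _ _.
suff : s = - s by lra.
rewrite -sumrN /s (reindex_inj (@oppr_inj 'I_n)); apply: eq_bigr => k _.
exact: sin_ang_opp.
Qed.

(** The sum S is invariant under a unit shift of the index; expanding the shifted
cosine and using that the sines sum to zero gives S = cos (ang i 1) * S, and
cos (ang i 1) is not 1 because the half angle lies strictly between 0 and pi. *)
Lemma sum_cos_ang i : (0 < i < n'.+1)%N -> \sum_(k < n'.+1) cos (ang i k) = 0.
Proof.
move=> /andP[i0 ilt].
have shift b : \sum_(k < n'.+1) cos (ang i k + ang i b) =
    \sum_(k < n'.+1) cos (ang i k).
  have h : injective (fun k : 'I_n => k + inZp b).
    by move=> x y /addIr.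
  rewrite [RHS](reindex_inj h); apply: eq_bigr => k _ /=.
  by rewrite -angD -[LHS]cos_ang_mod -modnDmr.
have e : (1 - cos (ang i 1)) * \sum_(k < n'.+1) cos (ang i k) = 0.
  rewrite mulrBl mul1r mulr_sumr.
  have := shift 1; under eq_bigr do rewrite cosD.
  rewrite big_split/= sumrN -[X in _ - X]mulr_suml sum_sin_ang mul0r subr0 => <-.
  by apply/eqP; rewrite subr_eq0; apply/eqP/eq_bigr => k _; rewrite mulrC.
move/eqP: e; rewrite mulf_eq0 => /orP[|/eqP //].
rewrite (_ : ang i 1 = (i%:R * pi / n'.+1%:R) *+ 2); last first.
  by rewrite /ang muln1 -mulr_natr; have : n'.+1%:R != 0 :> R by []; move=> ?; field.
rewrite cos_mulr2n cos2sin2.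
have : 0 < sin (i%:R * pi / n'.+1%:R : R).
  apply: sin_gt0_pi; rewrite divr_gt0 ?mulr_gt0 ?pi_gt0 ?ltr0n//=.
  by rewrite ltr_pdivrMr ?ltr0n// mulrC ltr_pM2l ?pi_gt0// ltr_nat.
move=> s0; have /lt0r_neq0 : 0 < 1 - ((1 - sin (i%:R * pi / n'.+1%:R : R) ^+ 2) *+ 2 - 1).
  by rewrite -mulr_natr; have := exprn_gt0 2 s0; lra.
by move=> /negbTE ->.
Qed.

Lemma sum_cos_angB i j : (i < n'.+1)%N -> (j < n'.+1)%N ->
  \sum_(k < n'.+1) cos (ang i k - ang j k) = if i == j then n'.+1%:R else 0.
Proof.
wlog ij : i j / (i <= j)%N.
  move=> h; case: (leqP i j) => ij il jl; first exact: h.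
  rewrite eq_sym -h// 1?ltnW//; apply: eq_bigr => k _.
  by rewrite -cosN opprB.
move=> il jl; case: eqVneq => [->|ne].
  under eq_bigr do rewrite subrr cos0.
  by rewrite sumr_const card_ord.
rewrite -[RHS](@sum_cos_ang (j - i)); last first.
  by rewrite subn_gt0 ltn_neqAle ne ij (leq_ltn_trans (leq_subr _ _)).
apply: eq_bigr => k _; rewrite -cosN opprB; congr cos.
by rewrite ![ang _ k]angC -{1}(subnK ij) angD addrK.
Qed.

(** From cas x * cas y = cos (x - y) + sin (x + y). *)
Lemma cas_orth i j : (i < n'.+1)%N -> (j < n'.+1)%N ->
  \sum_(k < n'.+1) cas k i * cas k j = if i == j then n'.+1%:R else 0.
Proof.
move=> il jl; rewrite -sum_cos_angB//.
rewrite -[RHS]addr0 -[X in _ + X](sum_sin_ang (i + j)) -big_split/=; apply: eq_bigr => k _.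
rewrite [ang (i + j) _]angC angD /cas cosB sinD ![ang k _]angC; ring.
Qed.
End Hartley.

(** * Hartley transform, convolution and large sieve *)

Section FiniteSums.
Variables (R : realType).

(** Lagrange's identity. *)
Lemma sum_cauchy_schwarz (I : finType) (a b : I -> R) :
  (\sum_i a i * b i) ^+ 2 <= (\sum_i a i ^+ 2) * (\sum_i b i ^+ 2).
Proof.
have : 0 <= \sum_i \sum_j (a i * b j - a j * b i) ^+ 2.
  by apply: sumr_ge0 => i _; apply: sumr_ge0 => j _; exact: sqr_ge0.
suff -> : \sum_i \sum_j (a i * b j - a j * b i) ^+ 2 =
    2 * ((\sum_i a i ^+ 2) * (\sum_i b i ^+ 2) - (\sum_i a i * b i) ^+ 2).
  by rewrite pmulr_rge0// subr_ge0.
have e i j : (a i * b j - a j * b i) ^+ 2 = a i ^+ 2 * b j ^+ 2 +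
    a j ^+ 2 * b i ^+ 2 - 2 * ((a i * b i) * (a j * b j)) by ring.
under eq_bigr => i _ do under eq_bigr => j _ do rewrite e.
under eq_bigr do rewrite sumrB big_split/= -!mulr_sumr -mulr_suml.
rewrite sumrB big_split/= -mulr_suml -!mulr_sumr -mulr_suml; ring.
Qed.
End FiniteSums.

Section Spectrum.
Variables (R : realType) (n' : nat).
Let n := n'.+1.
Implicit Types (k l : 'I_n).
Local Notation cas := (@cas R n').
Local Notation ang := (@ang R n').

Definition hartley p (a : 'I_p -> R) (k : nat) : R := \sum_(i < p) a i * cas k i.
Definition cosT p (a : 'I_p -> R) (k : nat) : R := \sum_(i < p) a i * cos (ang k i).
Definition sinT p (a : 'I_p -> R) (k : nat) : R := \sum_(i < p) a i * sin (ang k i).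
(** The squared modulus of the discrete Fourier transform. *)
Definition power p (a : 'I_p -> R) k : R := cosT a k ^+ 2 + sinT a k ^+ 2.
Definition gram p k l : R := \sum_(i < p) cas k i * cas l i.

Lemma hartleyE p (a : 'I_p -> R) (k : nat) : hartley a k = cosT a k + sinT a k.
Proof. by rewrite -big_split; apply: eq_bigr => i _; rewrite /= -mulrDr. Qed.

Lemma cosT_opp p (a : 'I_p -> R) k : cosT a (- k) = cosT a k.
Proof.
by apply: eq_bigr => i _; rewrite ![ang _ i]angC cos_ang_opp.
Qed.

Lemma sinT_opp p (a : 'I_p -> R) k : sinT a (- k) = - sinT a k.
Proof.
rewrite -sumrN; apply: eq_bigr => i _.
by rewrite ![ang _ i]angC sin_ang_opp mulrN.
Qed.

Lemma power_opp p (a : 'I_p -> R) k : power a (- k) = power a k.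
Proof. by rewrite /power cosT_opp sinT_opp sqrrN. Qed.

Lemma powerE p (a : 'I_p -> R) k : power a k = (hartley a k ^+ 2 + hartley a (- k) ^+ 2) / 2.
Proof. rewrite !hartleyE cosT_opp sinT_opp /power; by field. Qed.

(** The cross term cosT k * sinT k of the square of a Hartley coefficient is odd
in k, so it disappears against an even weight. *)
Lemma sum_even_hartley p (a : 'I_p -> R) (g : 'I_n -> R) : (forall k, g (- k) = g k) ->
  \sum_k g k * hartley a k ^+ 2 = \sum_k g k * power a k.
Proof.
move=> ge; pose s := \sum_k g k * (2 * (cosT a k * sinT a k)).
have s0 : s = 0.
  suff : s = - s by lra.
  rewrite -sumrN /s (reindex_inj (@oppr_inj 'I_n)); apply: eq_bigr => k _.
  by rewrite ge cosT_opp sinT_opp !mulrN.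
rewrite -[RHS]addr0 -[X in _ + X]s0 -big_split/=; apply: eq_bigr => k _.
rewrite hartleyE /power; ring.
Qed.

Lemma parseval_hartley p (a : 'I_p -> R) : (p <= n)%N ->
  \sum_(k : 'I_n) hartley a k ^+ 2 = n%:R * \sum_i a i ^+ 2.
Proof.
move=> pn.
under eq_bigr do rewrite expr2 big_distrlr/=.
rewrite exchange_big/= mulr_sumr; apply: eq_bigr => i _.
rewrite exchange_big/=.
under eq_bigr => j _.
  under eq_bigr => k _ do rewrite mulrACA.
  rewrite -mulr_sumr.
  rewrite cas_orth ?(leq_trans (ltn_ord _) pn)//; over.
rewrite (bigD1 i)//= eqxx big1 ?addr0.
  by rewrite mulrC -expr2.
move=> j ji; rewrite (_ : (i == j :> nat) = false) ?mulr0//.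
by apply/negbTE; rewrite eq_sym.
Qed.

(** Parseval applied twice, once in each frequency. Although the Gram matrix is
n by n with trace of order p n, its total squared mass is only p n ^ 2: most
pairs of frequencies are nearly orthogonal already on the first p positions. *)
Lemma sum_sqr_gram p : (p <= n)%N ->
  \sum_k \sum_l gram p k l ^+ 2 = p%:R * n%:R ^+ 2.
Proof.
move=> pn.
under eq_bigr => k _.
  rewrite (_ : \sum_l _ = \sum_(l : 'I_n) hartley (fun i : 'I_p => cas k i) l ^+ 2)//.
  rewrite parseval_hartley//; over.
rewrite -mulr_sumr exchange_big/= expr2 mulrA [RHS]mulrC; congr (_ * _).
under eq_bigr => i _.
  under eq_bigr do rewrite expr2.
  rewrite cas_orth ?(leq_trans (ltn_ord _) pn)// eqxx; over.
by rewrite sumr_const card_ord mulr_natl.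
Qed.

Definition cyclic_conv p (v : 'I_p -> R) (x : 'I_n -> R) (j : 'I_n) : R :=
  \sum_(i < p) v i * x (j - inZp i).

Lemma cyclic_conv_transform (h : R -> R) p (v : 'I_p -> R) (x : 'I_n -> R) (k : nat) :
  (forall i, h (ang k (i %% n)) = h (ang k i)) ->
  \sum_j cyclic_conv v x j * h (ang k j) =
  \sum_(i < p) \sum_(j : 'I_n) (v i * x j) * h (ang k j + ang k i).
Proof.
move=> hmod; under eq_bigr do rewrite mulr_suml.
rewrite exchange_big/=; apply: eq_bigr => i _.
have inj : injective (fun j : 'I_n => j + inZp i) by move=> u w /addIr.
rewrite (reindex_inj inj); apply: eq_bigr => j _.
by rewrite addrK/= modnDmr hmod angD.
Qed.

Lemma cosT_cyclic_conv p (v : 'I_p -> R) (x : 'I_n -> R) k :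
  cosT (cyclic_conv v x) k = cosT v k * cosT x k - sinT v k * sinT x k.
Proof.
rewrite /cosT /sinT cyclic_conv_transform; last by move=> i; rewrite cos_ang_mod.
rewrite !big_distrlr/= -sumrB; apply: eq_bigr => i _.
rewrite -sumrB; apply: eq_bigr => j _; rewrite cosD; ring.
Qed.

Lemma sinT_cyclic_conv p (v : 'I_p -> R) (x : 'I_n -> R) k :
  sinT (cyclic_conv v x) k = cosT v k * sinT x k + sinT v k * cosT x k.
Proof.
rewrite /cosT /sinT cyclic_conv_transform; last by move=> i; rewrite sin_ang_mod.
rewrite !big_distrlr/= -big_split; apply: eq_bigr => i _.
rewrite -big_split; apply: eq_bigr => j _; rewrite sinD/=; ring.
Qed.

(** The convolution theorem. As the power of x is an even function of k, the power
of v can be replaced by the square of its Hartley coefficient. *)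
Lemma cyclic_conv_energy p (v : 'I_p -> R) (x : 'I_n -> R) :
  n%:R * \sum_j cyclic_conv v x j ^+ 2 = \sum_k power x k * hartley v k ^+ 2.
Proof.
rewrite sum_even_hartley; last by move=> k; rewrite power_opp.
rewrite -parseval_hartley//.
transitivity (\sum_(k : 'I_n) 1 * hartley (cyclic_conv v x) k ^+ 2).
  by apply: eq_bigr => k _; rewrite mul1r.
rewrite sum_even_hartley//; apply: eq_bigr => k _.
rewrite /power cosT_cyclic_conv sinT_cyclic_conv; ring.
Qed.

(** A Bellman-Boas form of the large sieve. With c the restriction to S of the
coefficients of v and g the combination of the kernels with coefficients c, the
sum A of squared coefficients equals the inner product of v and g, so by
Cauchy-Schwarz A ^ 2 <= |v| ^ 2 |g| ^ 2. Expanding |g| ^ 2 over pairs (k, l), the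
pairs with l = k or l = - k contribute at most 2 p A, since
cas k ^ 2 + cas (- k) ^ 2 = 2 at every position, and the others contribute at most
F A, because the operator norm of a matrix is at most its Frobenius norm. *)
Lemma large_sieve p (v : 'I_p -> R) (S : pred 'I_n) (F : R) :
  0 <= F -> (forall k, S k -> - k != k) ->
  \sum_k \sum_(l | [&& S k, S l, l != k & l != - k]) gram p k l ^+ 2 <= F ^+ 2 ->
  \sum_(k | S k) hartley v k ^+ 2 <= (2 * p%:R + F) * \sum_i v i ^+ 2.
Proof.
move=> F0 Sopp SF.
pose c k := if S k then hartley v k else 0.
have cS k : ~~ S k -> c k = 0 by rewrite /c => /negbTE ->.
set A := \sum_(k | S k) _; set N := \sum_i _.
have Ac : A = \sum_k c k ^+ 2.
  rewrite /A big_mkcond; apply: eq_bigr => k _; rewrite /c.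
  by case: ifP => //; rewrite expr0n.
have N0 : 0 <= N by apply: sumr_ge0 => i _; exact: sqr_ge0.
have A0 : 0 <= A by rewrite Ac; apply: sumr_ge0 => i _; exact: sqr_ge0.
pose g (i : 'I_p) := \sum_k c k * cas k i.
have Ag : A = \sum_i v i * g i.
  rewrite /g; under [RHS]eq_bigr do rewrite mulr_sumr.
  rewrite exchange_big/= /A big_mkcond; apply: eq_bigr => k _.
  rewrite /c; case: ifP => Sk; last by rewrite big1// => i _; rewrite mul0r mulr0.
  rewrite expr2 {2}/hartley mulr_sumr; apply: eq_bigr => i _; ring.
have gE : \sum_i g i ^+ 2 = \sum_k \sum_l (c k * c l) * gram p k l.
  rewrite /g; under eq_bigr do rewrite expr2 big_distrlr/=.
  rewrite exchange_big/=; apply: eq_bigr => k _.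
  rewrite exchange_big/=; apply: eq_bigr => l _.
  rewrite /gram mulr_sumr; apply: eq_bigr => i _; ring.
pose Off k l := [&& S k, S l, l != k & l != - k].
have gsplit : \sum_i g i ^+ 2 =
    \sum_(i < p) (\sum_k ((c k * cas k i) ^+ 2 + (c k * cas k i) * (c (- k) * cas (- k) i))) +
    \sum_k \sum_(l | Off k l) (c k * c l) * gram p k l.
  rewrite gE [X in X + _]exchange_big/= -big_split/=; apply: eq_bigr => k _.
  have [Sk|Sk] := boolP (S k); last first.
    rewrite big1 => [|l _]; last by rewrite (cS _ Sk) !mul0r.
    rewrite big1 => [|i _]; last by rewrite (cS _ Sk) !mul0r expr0n addr0.
    by rewrite big1 ?addr0// => l _; rewrite (cS _ Sk) !mul0r.
  rewrite (bigID (fun l => (l == k) || (l == - k)))/=; congr (_ + _).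
    rewrite (bigD1 k) ?eqxx//= (bigD1 (- k)); last first.
      by rewrite eqxx orbT/= Sopp.
    rewrite big1 => [|l]; last by case/andP => /andP[/orP[] -> //=]; rewrite ?andbF.
    rewrite /= addr0 /gram !mulr_sumr -big_split; apply: eq_bigr => i _ /=; ring.
  rewrite big_mkcond [RHS]big_mkcond; apply: eq_bigr => l _.
  rewrite negb_or /Off Sk/=; have [Sl|Sl] := boolP (S l) => //=.
  by rewrite (cS _ Sl) mulr0 mul0r; case: ifP.
have diag (i : 'I_p) : \sum_k ((c k * cas k i) ^+ 2 + (c k * cas k i) * (c (- k) * cas (- k) i))
    <= 2 * A.
  pose r (k : 'I_n) := c k * cas k i.
  have e : 2 * \sum_k (r k ^+ 2 + r k * r (- k)) = \sum_k (r k + r (- k)) ^+ 2.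
    have h : \sum_k r k ^+ 2 = \sum_k r (- k) ^+ 2.
      by rewrite (reindex_inj (@oppr_inj 'I_n)).
    rewrite big_split/= mulrDr mulr_natl mulr2n {2}h -big_split/= mulr_sumr -big_split/=.
    by apply: eq_bigr => k _; ring.
  rewrite -(@ler_pM2l _ 2)// e.
  have h : \sum_k c (- k) ^+ 2 = A.
    by rewrite Ac [RHS](reindex_inj (@oppr_inj 'I_n)).
  rewrite (_ : 2 * (2 * A) = \sum_k 2 * (c k ^+ 2 + c (- k) ^+ 2)); last first.
    by rewrite -mulr_sumr big_split/= h -Ac; ring.
  apply: ler_sum => k _; rewrite -(sqr_cas_opp R k i) /r -subr_ge0.
  set a := cas _ _; set b := cas _ _.
  by rewrite [X in 0 <= X](_ : _ = (a * c (- k) - b * c k) ^+ 2) ?sqr_ge0//; ring.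
have off : \sum_k \sum_(l | Off k l) (c k * c l) * gram p k l <= F * A.
  have FA0 : 0 <= F * A by rewrite mulr_ge0.
  rewrite (le_trans (ler_norm _))// -(@ler_pXn2r _ 2)// ?nnegrE ?normr_ge0//.
  rewrite real_normK ?num_real//.
  pose G (q : 'I_n * 'I_n) := if Off q.1 q.2 then gram p q.1 q.2 else 0.
  have -> : \sum_k \sum_(l | Off k l) (c k * c l) * gram p k l =
     \sum_(q : 'I_n * 'I_n) (c q.1 * c q.2) * G q.
    rewrite [RHS](eq_bigr (fun q => (c q.1 * c q.2) * G (q.1, q.2))); last by case.
    rewrite -(pair_bigA _ (fun k l => (c k * c l) * G (k, l)))/=.
    apply: eq_bigr => k _; rewrite big_mkcond; apply: eq_bigr => l _.
    by rewrite /G/=; case: ifP => // _; rewrite mulr0.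
  rewrite (le_trans (sum_cauchy_schwarz _ _))// exprMn mulrC.
  have -> : \sum_(q : 'I_n * 'I_n) (c q.1 * c q.2) ^+ 2 = A ^+ 2.
    rewrite -(pair_bigA _ (fun k l => (c k * c l) ^+ 2))/=.
    rewrite expr2 Ac big_distrlr/=; apply: eq_bigr => k _.
    by apply: eq_bigr => l _; rewrite exprMn.
  apply: ler_wpM2r; first exact: sqr_ge0.
  apply: le_trans SF.
  rewrite [leLHS](eq_bigr (fun q => G (q.1, q.2) ^+ 2)); last by case.
  rewrite -(pair_bigA _ (fun k l => G (k, l) ^+ 2))/=.
  rewrite le_eqVlt; apply/orP; left; apply/eqP.
  apply: eq_bigr => k _; rewrite [RHS]big_mkcond; apply: eq_bigr => l _.
  by rewrite /G/= -/(Off k l); case: ifP => //; rewrite expr0n.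
have gle : \sum_i g i ^+ 2 <= (2 * p%:R + F) * A.
  rewrite gsplit mulrDl lerD//.
  rewrite (le_trans (ler_sum _ (fun i _ => diag i)))//.
  by rewrite sumr_const card_ord -[leLHS]mulr_natr mulrAC.
have : A ^+ 2 <= N * ((2 * p%:R + F) * A).
  by rewrite {1}Ag (le_trans (sum_cauchy_schwarz _ _))// ler_wpM2l.
have [->|An0] := eqVneq A 0.
  by move=> _; rewrite mulr_ge0// addr_ge0// mulr_ge0.
have Ap : 0 < A by rewrite lt_neqAle eq_sym An0.
by rewrite expr2 mulrA ler_pM2r// mulrC.
Qed.
End Spectrum.

(** * The smallest eigenvalue as a minimum of a quadratic form *)

Section Rayleigh.
Variables (R : realType) (p' : nat).
Local Notation p := p'.+1.
Implicit Types (A : 'M[R]_p) (u v w : 'rV[R]_p).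

Definition form A u v : R := (u *m A *m v^T) 0 0.
Definition normsq v : R := \sum_i v 0 i ^+ 2.

Lemma formE A u v : form A u v = \sum_j (\sum_i u 0 i * A i j) * v 0 j.
Proof.
rewrite /form mxE; apply: eq_bigr => j _; rewrite !mxE; congr (_ * _).
Qed.

Lemma normsqE v : normsq v = (v *m v^T) 0 0.
Proof. by rewrite mxE; apply: eq_bigr => i _; rewrite mxE expr2. Qed.

Lemma normsq_ge0 v : 0 <= normsq v.
Proof. by apply: sumr_ge0 => i _; exact: sqr_ge0. Qed.

Lemma normsq_eq0 v : normsq v = 0 -> v = 0.
Proof.
move=> /eqP; rewrite psumr_eq0; last by move=> i _; exact: sqr_ge0.
move=> /allP h; apply/rowP => i; rewrite mxE; apply/eqP.
by have := h i; rewrite mem_index_enum sqrf_eq0 => /(_ isT).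
Qed.

Lemma normsqZ (t : R) v : normsq (t *: v) = t ^+ 2 * normsq v.
Proof. by rewrite /normsq mulr_sumr; apply: eq_bigr => i _; rewrite mxE exprMn. Qed.

Lemma form_sym A u v : A^T = A -> form A u v = form A v u.
Proof.
move=> As; rewrite /form -[in LHS](trmxK (u *m A *m v^T)) mxE.
by rewrite !trmx_mul trmxK As mulmxA.
Qed.

Lemma formZ A (t : R) v : form A (t *: v) (t *: v) = t ^+ 2 * form A v v.
Proof.
by rewrite /form linearZ/= -!scalemxAl -!scalemxAr !mxE mulrA.
Qed.

Lemma form_line A u v (t : R) : A^T = A ->
  form A (u + t *: v) (u + t *: v) =
  form A u u + 2 * t * form A u v + t ^+ 2 * form A v v.
Proof.
move=> As; have := @form_sym A u v As.
rewrite /form linearD/= linearZ/= !mulmxDl !mulmxDr -!scalemxAl -!scalemxAr !mxE.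
move=> ->; ring.
Qed.

Lemma form_subscalar A (a : R) u v : form (A - a%:M) u v = form A u v - a * (u *m v^T) 0 0.
Proof.
by rewrite /form mulmxBr mulmxBl mul_mx_scalar -scalemxAl mxE [in X in _ + X]mxE [in X in _ + X]mxE.
Qed.

Lemma continuous_form A : continuous (fun v => form A v v).
Proof.
under eq_fun do rewrite formE.
apply: continuous_big => [|j _ v]; first exact: add_continuous.
have h : continuous (fun w : 'rV[R]_p => \sum_i w 0 i * A i j).
  apply: continuous_big => [|i _ w]; first exact: add_continuous.
  by apply: continuousM; [exact: coord_continuous|exact: cst_continuous].
by apply: continuousM; [exact: h|exact: coord_continuous].
Qed.

Lemma continuous_normsq : continuous normsq.
Proof.
apply: continuous_big => [|i _ v]; first exact: add_continuous.
by apply: continuousM; exact: coord_continuous.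
Qed.

Lemma compact_sphere : compact [set v : 'rV[R]_p | normsq v = 1].
Proof.
apply: bounded_closed_compact; last first.
  have -> : [set v : 'rV[R]_p | normsq v = 1] = normsq @^-1` [set 1].
    by apply/seteqP; split.
  apply: closed_comp => [v _|]; [exact: continuous_normsq | exact: closed_eq].
exists 1; split => // M M1 v /= v1.
rewrite (_ : `|v| = mx_norm v)// mx_normrE; apply/bigmax_leP; split => [|[i j] _ /=].
  by rewrite (le_trans _ (ltW M1)).
rewrite (le_trans _ (ltW M1))// ord1 -(@ler_pXn2r _ 2)// ?nnegrE//.
rewrite real_normK ?num_real// expr1n -v1 /normsq (bigD1 j)//= lerDl.
by apply: sumr_ge0 => k _; exact: sqr_ge0.
Qed.

(** The minimum 0 of a positive semidefinite form is attained only on the kernel: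
move from v in the direction of v A with a small negative step. *)
Lemma psd_kernel A v : A^T = A -> (forall u, 0 <= form A u u) -> form A v v = 0 ->
  v *m A = 0.
Proof.
move=> As A0 v0; apply: normsq_eq0; set u := v *m A.
have vu : form A v u = normsq u by rewrite normsqE.
set s := normsq u; have s0 : 0 <= s by exact: normsq_ge0.
have c0 := A0 u; set c := form A u u in c0.
(* The step is near the minimizer -s/c of 2ts + t^2 c; c + 1 avoids a zero denominator. *)
have := A0 (v + (- s / (c + 1)) *: u).
rewrite form_line// v0 vu -/s -/c add0r.
have c1 : 0 < c + 1 by rewrite ltr_wpDl.
rewrite (_ : _ + _ = - (s ^+ 2 * ((c + 2) / (c + 1) ^+ 2))); last by field; exact: lt0r_neq0.
rewrite oppr_ge0 pmulr_lle0; last by rewrite divr_gt0 ?exprn_gt0// ltr_wpDl.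
by rewrite le_eqVlt ltNge sqr_ge0 orbF sqrf_eq0 => /eqP.
Qed.

(** The minimum of the form on the unit sphere exists by compactness, and a
minimizer v is an eigenvector since the form shifted by that minimum is positive
semidefinite and vanishes at v. *)
Lemma exists_min_eigenvalue A : A^T = A ->
  exists a, eigenvalue A a /\ forall v, a * normsq v <= form A v v.
Proof.
move=> As.
have [] := @EVT_min_rV R p (fun v => form A v v) [set v | normsq v = 1].
- exists (delta_mx 0 0) => /=; rewrite /normsq (bigD1 ord0)//= big1.
    by rewrite mxE eqxx addr0 expr1n.
  by move=> i i0; rewrite mxE/= (negbTE i0) expr0n.
- exact: compact_sphere.
- by apply: continuous_subspaceT; exact: continuous_form.
move=> v; rewrite inE/= => v1 vmin; pose a := form A v v; exists a.
have amin u : a * normsq u <= form A u u.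
  have [u0|u0] := eqVneq (normsq u) 0.
    by rewrite (normsq_eq0 u0) /form mul0mx mul0mx mxE -(normsq_eq0 u0) u0 mulr0.
  have up : 0 < normsq u by rewrite lt_neqAle eq_sym u0 normsq_ge0.
  have := vmin ((Num.sqrt (normsq u))^-1 *: u).
  rewrite inE/= normsqZ exprVn sqr_sqrtr ?normsq_ge0// mulVf// => /(_ erefl).
  by rewrite formZ exprVn sqr_sqrtr ?normsq_ge0// ler_pdivlMl// mulrC.
split=> //; apply/eigenvalueP; exists v; last first.
  apply/eqP => v0; move: v1; rewrite v0 /normsq big1 => [/esym/eqP|i _].
    by rewrite oner_eq0.
  by rewrite mxE expr0n.
apply/eqP; rewrite -subr_eq0 -mul_mx_scalar -mulmxBr; apply/eqP.
apply: psd_kernel.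
- by rewrite linearB/= As tr_scalar_mx.
- by move=> u; rewrite form_subscalar -normsqE subr_ge0.
- by rewrite form_subscalar -normsqE v1 mulr1 subrr.
Qed.

Lemma eigenvalue_form A a : eigenvalue A a ->
  exists2 v, 0 < normsq v & form A v v = a * normsq v.
Proof.
move=> /eigenvalueP[v vA v0]; exists v.
  rewrite lt_neqAle normsq_ge0 andbT eq_sym.
  by apply/contra: v0 => /eqP /normsq_eq0 ->.
by rewrite /form vA -scalemxAl mxE -normsqE.
Qed.

Lemma le_smallest_eigenvalue A (t : R) : A^T = A ->
  t <= smallest_eigenvalue A <-> forall v, t * normsq v <= form A v v.
Proof.
move=> As; have [a [ea amin]] := exists_min_eigenvalue As.
have ale b : eigenvalue A b -> a <= b.
  move=> /eigenvalue_form[v v0 vb]; have := amin v.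
  by rewrite vb ler_pM2r.
have -> : smallest_eigenvalue A = a.
  rewrite /smallest_eigenvalue; case: xgetP => [b _ [eb bmin]|/(_ a)/=].
    by apply/eqP; rewrite eq_le ale// bmin.
  by case.
split=> [ta v|h].
  by rewrite (le_trans _ (amin v))// ler_wpM2r// normsq_ge0.
by have [v v0 va] := eigenvalue_form ea; have := h v; rewrite va ler_pM2r.
Qed.

(** Both sides are continuous in v and rational vectors are dense. *)
Lemma form_ge_dense A (t : R) :
  (forall r : 'rV[rat]_p, t * normsq (map_mx ratr r) <= form A (map_mx ratr r) (map_mx ratr r)) ->
  forall v, t * normsq v <= form A v v.
Proof.
move=> h v; rewrite leNgt; apply/negP => vlt.
pose g w := form A w w - t * normsq w.
have gc : continuous g.
  move=> u; apply: (@continuousB _ _ _ (fun w => form A w w) (fun w => t * normsq w)).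
    exact: continuous_form.
  by apply: continuousM; [exact: cst_continuous | exact: continuous_normsq].
have : \forall w \near v, g w < 0.
  have /cvgr_lt : g w @[w --> v] --> g v by exact: gc.
  by apply; rewrite subr_lt0.
move=> /nbhs_ballP[e/= e0 ve].
have rat_near i : exists q : rat, `|v 0 i - ratr q| < e.
  have /rat_in_itvoo[q] : v 0 i - e < v 0 i + e by move: (e0); lra.
  rewrite in_itv/= => /andP[q1 q2]; exists q.
  by rewrite ltr_distl; move: q1 q2; lra.
pose r := \row_i projT1 (cid (rat_near i)).
have := ve (map_mx ratr r).
have rb : ball v e (map_mx ratr r).
  split=> // i j; rewrite /ball/= ord1 !mxE.
  by case: cid.
by move=> /(_ rb); rewrite subr_lt0 ltNge h.
Qed.

(** By the variational characterization the event is a countable union (over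
margins 1 / (m + 1)) of countable intersections (over rational vectors) of
inequalities between measurable functions. *)
Lemma measurable_smallest_eigenvalue_gt d (T : measurableType d) (A : T -> 'M[R]_p)
    (t : R) :
  (forall z, (A z)^T = A z) ->
  (forall i j, measurable_fun setT (fun z => A z i j)) ->
  measurable [set z | t < smallest_eigenvalue (A z)].
Proof.
move=> As mA.
pose E (m : nat) (r : 'rV[rat]_p) : set T :=
  [set z | (t + m.+1%:R^-1) * normsq (map_mx ratr r) <=
    form (A z) (map_mx ratr r) (map_mx ratr r)].
have -> : [set z | t < smallest_eigenvalue (A z)] = \bigcup_m \bigcap_r E m r.
  apply/seteqP; split => [z /= tl|z [m _ zm]/=].
    have d0 : 0 < smallest_eigenvalue (A z) - t by rewrite subr_gt0.
    pose m := Num.truncn (smallest_eigenvalue (A z) - t)^-1.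
    exists m => // r _; rewrite /E/=; apply: (le_smallest_eigenvalue _ (As z)).1.
    rewrite -lerBrDl invf_ple ?posrE ?ltr0n//.
    by rewrite ltW// truncnS_gt.
  rewrite (@lt_le_trans _ _ (t + m.+1%:R^-1))// ?ltrDl ?invr_gt0 ?ltr0n//.
  apply: (le_smallest_eigenvalue _ (As z)).2; apply: form_ge_dense => r.
  exact: (zm r I).
apply: bigcup_measurable => m _.
rewrite -[X in measurable X]setCK; apply: measurableC; rewrite setC_bigcap.
apply: (@countable_bigcupT_measurable _ _ _ (fun r => ~` E m r)).
  exact: countableP.
move=> r; apply: measurableC; rewrite -[E m r]setTI.
apply: measurable_fun_le => //.
under eq_fun do rewrite formE.
apply: measurable_sum => j; apply: measurable_funM => //.
by apply: measurable_sum => i; apply: measurable_funM.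
Qed.

End Rayleigh.

(** * Bounded measurable functions *)

Section BoundedMeasurable.
Context (R : realType).

Definition bounded_measurable d (T : measurableType d) (f : T -> R) :=
  measurable_fun setT f /\ exists M, forall w, `|f w| <= M.

Lemma bounded_measurable_integrable d (T : measurableType d) (P : probability T R)
    (f : T -> R) : bounded_measurable f -> P.-integrable setT (EFin \o f).
Proof.
move=> [mf [M fM]]; apply: measurable_bounded_integrable => //.
  by rewrite ltey_eq fin_num_measure.
by exists M; split => [|x Mx y _]; [exact: num_real|exact: le_trans (fM y) (ltW Mx)].
Qed.

Lemma bounded_measurableM d (T : measurableType d) (f g : T -> R) :
  bounded_measurable f -> bounded_measurable g ->
  bounded_measurable (fun w => f w * g w).
Proof.
move=> [mf [M fM]] [mg [N gN]]; split; first exact: measurable_funM.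
by exists (M * N) => w; rewrite normrM ler_pM.
Qed.

Lemma bounded_measurable_comp d1 d2 (T1 : measurableType d1) (T2 : measurableType d2)
  (f : T1 -> T2) (g : T2 -> R) : measurable_fun setT f -> bounded_measurable g ->
  bounded_measurable (g \o f).
Proof.
move=> mf [mg [M gM]]; split; first exact: measurableT_comp.
by exists M => w; exact: gM.
Qed.

Lemma bounded_measurable_cos d (T : measurableType d) (f : T -> R) :
  measurable_fun setT f -> bounded_measurable (fun w => cos (f w)).
Proof.
move=> mf; apply: (@bounded_measurable_comp _ _ _ _ f cos mf); split.
  exact: continuous_measurable_fun (@continuous_cos R).
by exists 1 => w; rewrite ler_norml cos_geN1 cos_le1.
Qed.

Definition gauss_weight (t y : R) : R := expR (- (y ^+ 2 / (2 * t))).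

Lemma bounded_measurable_weight d (T : measurableType d) (f : T -> R) (t : R) :
  0 < t -> measurable_fun setT f -> bounded_measurable (fun w => gauss_weight t (f w)).
Proof.
move=> t0 mf; rewrite /gauss_weight; split.
  apply: measurableT_comp => //; apply: measurableT_comp => //.
  by apply: measurable_funM => //; exact: measurable_funX.
exists 1 => w; rewrite ger0_norm ?expR_ge0// -expR0 ler_expR oppr_le0.
by rewrite divr_ge0 ?sqr_ge0// mulr_ge0// ltW.
Qed.
End BoundedMeasurable.

(** * The characteristic function of the normal law *)

(** The integral over [-n, n] is G n - G (- n) and tends to the whole integral by
dominated convergence. *)
Lemma integral_derivative_vanishing (R : realType) (G g : R -> R) :
  (forall y, is_derive y (1:R) G (g y)) -> continuous g ->
  (@lebesgue_measure R).-integrable setT (EFin \o g) ->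
  G n%:R @[n --> \oo] --> (0:R) -> G (- n%:R) @[n --> \oo] --> (0:R) ->
  (\int[@lebesgue_measure R]_y (g y)%:E = 0)%E.
Proof.
move=> dG cg ig Gp Gm.
pose D (n : nat) : set R := `[- n%:R, n%:R]%classic.
have mg : measurable_fun setT (EFin \o g) by exact: measurable_int ig.
have [] := @dominated_convergence _ _ R (@lebesgue_measure R) setT measurableT
  (fun n => (EFin \o g) \_ (D n)) (EFin \o g) (abse \o (EFin \o g)).
- move=> n; apply/(measurable_restrictT _ _).1 => //.
    exact: measurable_itv.
  exact: measurable_funTS.
- exact: mg.
- apply: aeW => y _; apply: cvg_near_cst.
  exists (Num.truncn `|y|).+1 => // n /= yn.
  rewrite patchE mem_set// /D/= in_itv/= -ler_norml.
  by rewrite (le_trans (ltW (truncnS_gt _)))// ler_nat.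
- exact: integrable_abse.
- apply: aeW => y n _; rewrite patchE; case: ifP => // _.
  by rewrite abse0 abse_ge0.
move=> _ _ lim1.
have lim2 : (\int[@lebesgue_measure R]_y ((EFin \o g) \_ (D n)) y @[n --> \oo] --> 0)%E.
  have : (G n%:R - G (- n%:R))%:E @[n --> \oo] --> 0%:E.
    by apply: cvg_EFin; [exact: nearW|rewrite -(subrr 0); exact: cvgB].
  move=> lim0; apply: cvg_trans lim0; apply: near_eq_cvg; exists 1%N => // n /= n1.
  rewrite -integral_mkcond.
  have nn : - n%:R < n%:R :> R by rewrite gtrN// ltr0n.
  rewrite (@continuous_FTC2 R g G)//.
  - exact: continuous_subspaceT.
  - split => [y _|| ].
    + by have := dG y.
    + apply: cvg_at_right_filter.
      exact/differentiable_continuous/derivable1_diffP.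
    + apply: cvg_at_left_filter.
      exact/differentiable_continuous/derivable1_diffP.
  - by move=> y _; rewrite derive1E; exact: derive_val.
exact: (cvg_unique _ lim1 lim2).
Qed.

Section CharacteristicFunction.
Variable R : realType.
Local Notation mu := (@lebesgue_measure R).

Let phi (y : R) : R := expR (- (y ^+ 2 / 2)).

Let phi_normal : phi = normal_fun 0 1.
Proof.
apply/funext => y; rewrite /phi /normal_fun; congr expR.
by rewrite subr0 expr1n mulNr.
Qed.

Let is_derive_phi (y : R) : is_derive y (1:R) phi (- y * phi y).
Proof.
have h : is_derive y (1:R) (fun z : R => - (z ^+ 2 / 2)) (- y).
  by apply: is_derive_eq; rewrite /GRing.scale/=; field.
by apply: is_derive_eq; rewrite /GRing.scale/= mulrC.
Qed.

Let is_derive_cosl (b s y : R) : is_derive y (1:R) (fun z => cos (s * z + b))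
  (- s * sin (s * y + b)).
Proof.
have h : is_derive y (1:R) (fun z : R => s * z + b) s.
  by apply: is_derive_eq; rewrite /GRing.scale/=; ring.
by apply: is_derive_eq; rewrite /GRing.scale/=; ring.
Qed.

Let is_derive_sinl (b s y : R) : is_derive y (1:R) (fun z => sin (s * z + b)) (s * cos (s * y + b)).
Proof.
have h : is_derive y (1:R) (fun z : R => s * z + b) s.
  by apply: is_derive_eq; rewrite /GRing.scale/=; ring.
by apply: is_derive_eq; rewrite /GRing.scale/=; ring.
Qed.

Let integrable_le_normal (f : R -> R) (s : R) : s != 0 -> continuous f ->
  (forall y, `|f y| <= normal_fun 0 s y) -> mu.-integrable setT (EFin \o f).
Proof.
move=> s0 cf fle.
have mf : measurable_fun setT f by exact: continuous_measurable_fun.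
have iN : mu.-integrable setT (EFin \o normal_fun 0 s).
  have -> : EFin \o normal_fun 0 s =
      fun y => ((normal_peak s)^-1%:E * (normal_pdf 0 s y)%:E)%E.
    apply/funext => y /=; rewrite -EFinM normal_pdfE// mulrA mulVf ?mul1r//.
    by rewrite gt_eqF// normal_peak_gt0.
  by apply: integrableZl => //; exact: integrable_normal_pdf.
apply: le_integrable iN => //; first exact/measurable_EFinP.
move=> y _; rewrite lee_fin/= (le_trans (fle y))// ler_norm//.
Qed.

Let continuous_mul (f g : R -> R) : continuous f -> continuous g ->
  continuous (fun y => f y * g y).
Proof. by move=> cf cg y; apply: cvgM; [exact: cf|exact: cg]. Qed.

Let continuous_phi : continuous phi.
Proof.
move=> y; apply/differentiable_continuous/derivable1_diffP.
by have := is_derive_phi y.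
Qed.

Let continuous_cosl (b s : R) : continuous (fun y : R => cos (s * y + b)).
Proof.
move=> y; apply/differentiable_continuous/derivable1_diffP.
by have := is_derive_cosl b s y.
Qed.

Let continuous_sinl (b s : R) : continuous (fun y : R => sin (s * y + b)).
Proof.
move=> y; apply/differentiable_continuous/derivable1_diffP.
by have := is_derive_sinl b s y.
Qed.

Let ler_phi (a y : R) : `|a| <= 1 -> `|a * phi y| <= normal_fun 0 1 y.
Proof.
move=> b1; rewrite -phi_normal normrM [`|phi y|]ger0_norm ?expR_ge0//.
by rewrite -[leRHS]mul1r ler_wpM2r// expR_ge0.
Qed.

(** By |y| <= 1 + y ^ 2 / 4 <= exp (y ^ 2 / 4), the first moment is dominated by a
normal density of variance 2. *)
Let ler_id_phi (a y : R) : `|a| <= 1 ->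
  `|a * (y * phi y)| <= normal_fun 0 (Num.sqrt 2) y.
Proof.
move=> b1; rewrite normrM (@le_trans _ _ `|y * phi y|) ?ler_piMl//.
rewrite normrM [`|phi y|]ger0_norm ?expR_ge0//.
have -> : normal_fun 0 (Num.sqrt 2) y = expR (y ^+ 2 / 4) * phi y.
  rewrite /normal_fun /phi -expRD subr0 sqr_sqrtr//; congr expR; by field.
rewrite ler_wpM2r ?expR_ge0// (le_trans _ (expR_ge1Dx _))//.
rewrite -real_normK ?num_real//; have := sqr_ge0 (`|y| / 2 - 1).
by rewrite sqrrB expr1n expr_div_n; lra.
Qed.

(** The unnormalized characteristic function, with a phase b that covers its real
and imaginary parts at once. *)
Let J (b s : R) := (\int[mu]_y (cos (s * y + b) * phi y))%R.

Let sqrt2_neq0 : Num.sqrt 2 != 0 :> R.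
Proof. by rewrite gt_eqF// sqrtr_gt0. Qed.

Let cos_le1_norm (y : R) : `|cos y| <= 1.
Proof. by rewrite ler_norml cos_geN1 cos_le1. Qed.

Let sin_le1_norm (y : R) : `|sin y| <= 1.
Proof. by rewrite ler_norml sin_geN1 sin_le1. Qed.

Let integrable_cos_phi (b s : R) : mu.-integrable setT (EFin \o (fun y => cos (s * y + b) * phi y)).
Proof.
apply: (@integrable_le_normal _ 1) => //; last by move=> y; exact: ler_phi.
by apply: continuous_mul; [exact: continuous_cosl|exact: continuous_phi].
Qed.

Let integrable_sin_id_phi (b s : R) :
  mu.-integrable setT (EFin \o (fun y => sin (s * y + b) * (y * phi y))).
Proof.
apply: (@integrable_le_normal _ (Num.sqrt 2)) => //; last by move=> y; exact: ler_id_phi.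
apply: continuous_mul; first exact: continuous_sinl.
by apply: continuous_mul; [move=> ?; exact: cvg_id|exact: continuous_phi].
Qed.

Let sin_phi_cvg0 (b s : R) (u : nat -> R) : (forall n, `|u n| = n%:R) ->
  sin (s * u n + b) * phi (u n) @[n --> \oo] --> (0:R).
Proof.
move=> un.
have lim0 : expR (2^-1) * expR (- n%:R) @[n --> \oo] --> (0:R).
  by rewrite -(mulr0 (expR 2^-1)); apply: cvgM; [exact: cvg_cst|exact: cvgn_expR].
apply/norm_cvg0P; apply: squeeze_cvgr lim0; last exact: cvg_cst.
apply: nearW => n; rewrite normr_ge0/= normrM [`|phi _|]ger0_norm ?expR_ge0//.
rewrite (@le_trans _ _ (phi (u n))) ?ler_piMl ?expR_ge0//.
rewrite -expRD ler_expR -[u n ^+ 2]real_normK ?num_real// un.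
by have := sqr_ge0 (n%:R - 1 : R); rewrite sqrrB expr1n mulr1; lra.
Qed.

(** The boundary term sin (s y + b) * phi y vanishes at infinity. *)
Let integration_by_parts_phi (b s : R) :
  (\int[mu]_y (sin (s * y + b) * (y * phi y)))%R = s * J b s.
Proof.
pose g y := s * (cos (s * y + b) * phi y) - sin (s * y + b) * (y * phi y).
suff h : (\int[mu]_y (g y)%:E = 0)%E.
  apply/esym/eqP; rewrite -subr_eq0; apply/eqP.
  rewrite /J -RintegralZl// -RintegralB//.
    by rewrite /Rintegral h.
  exact: (@integrableZl _ _ _ _ _ measurableT s _ (integrable_cos_phi b s)).
apply: (@integral_derivative_vanishing _ (fun y => sin (s * y + b) * phi y)).
- by move=> y; apply: is_derive_eq; rewrite /GRing.scale/= /g /phi; field.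
- move=> y; apply: (@continuousB _ _ _ (fun y => s * (cos (s * y + b) * phi y))
    (fun y => sin (s * y + b) * (y * phi y))).
    move: y; apply: continuous_mul; first exact: cst_continuous.
    by apply: continuous_mul; [exact: continuous_cosl|exact: continuous_phi].
  move: y; apply: continuous_mul; first exact: continuous_sinl.
  by apply: continuous_mul; [move=> ?; exact: cvg_id|exact: continuous_phi].
- apply: (@integrableB _ _ _ mu setT measurableT
    (EFin \o (fun y => s * (cos (s * y + b) * phi y)))
    (EFin \o (fun y => sin (s * y + b) * (y * phi y)))) => //.
  exact: (@integrableZl _ _ _ _ _ measurableT s _ (integrable_cos_phi b s)).
- by apply: sin_phi_cvg0 => n; rewrite normr_nat.
- by apply: sin_phi_cvg0 => n; rewrite normrN normr_nat.
Qed.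

(** Differentiation under the integral sign followed by integration by parts: J
solves the differential equation J' = - s J. *)
Let is_derive_J (b s : R) : is_derive s (1:R) (J b) (- s * J b s).
Proof.
have dc y z : is_derive z (1:R) (fun t => cos (t * y + b) * phi y)
    (- (sin (z * y + b) * (y * phi y))).
  have h : is_derive z (1:R) (fun t : R => t * y + b) y.
    by apply: is_derive_eq; rewrite /GRing.scale/=; ring.
  by apply: is_derive_eq; rewrite /GRing.scale/=; ring.
have sI : s \in `]s - 1, s + 1[%R by rewrite in_itv/=; lra.
pose f (t y : R) := cos (t * y + b) * phi y.
pose G (y : R) := `|y| * phi y.
have G0 y : 0 <= G y by rewrite mulr_ge0// expR_ge0.
have iG : mu.-integrable setT (EFin \o G).
  apply: (@integrable_le_normal _ (Num.sqrt 2)) => //.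
    by apply: continuous_mul; [exact: norm_continuous|exact: continuous_phi].
  move=> y; have := @ler_id_phi 1 y; rewrite normr1 lexx => /(_ isT).
  by rewrite mul1r /G !normrM normr_id.
have d1f x y : (f ^~ y)^`()%classic x = - (sin (x * y + b) * (y * phi y)).
  by rewrite derive1E; exact: derive_val.
have fG x y : `]s - 1, s + 1[%classic x -> setT y -> `|(f ^~ y)^`()%classic x| <= G y.
  move=> _ _; rewrite d1f normrN normrM /G normrM [`|phi y|]ger0_norm ?expR_ge0//.
  by rewrite ler_piMl// mulr_ge0// expR_ge0.
have df x y : `]s - 1, s + 1[%classic x -> setT y -> derivable (f ^~ y) x 1.
  by move=> _ _; have := dc y x.
have intf x : `]s - 1, s + 1[%classic x -> mu.-integrable setT (EFin \o f x).
  by move=> _; exact: integrable_cos_phi.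
have := differentiation_under_integral measurableT sI intf df G0 iG fG.
have := derivable_under_integral measurableT sI intf df G0 iG fG.
move=> dJ Jv; apply: DeriveDef; first exact: dJ.
rewrite -derive1E [LHS]Jv mulNr -integration_by_parts_phi -mulN1r -RintegralZl//.
by apply: eq_Rintegral => y _; rewrite mulN1r; exact: d1f.
Qed.

Let JE (b s : R) : J b s = J b 0 * expR (- (s ^+ 2 / 2)).
Proof.
pose K (t : R) := J b t * expR (t ^+ 2 / 2).
have dK t : is_derive t (1:R) K 0.
  pose E (z : R) := expR (z ^+ 2 / 2).
  have dE : is_derive t (1:R) E (t * E t).
    by apply: is_derive_eq; rewrite /GRing.scale/= /E; field.
  have h := @is_deriveM _ _ (J b) E t 1 _ _ (is_derive_J b t) dE.
  suff <- : J b t *: (t * E t) + E t *: (- t * J b t) = 0 by exact: h.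
  by rewrite /GRing.scale/=; ring.
have := is_derive_0_is_cst s 0 dK; rewrite /K expr0n mul0r expR0 mulr1 => <-.
by rewrite -mulrA -expRD addrN expR0 mulr1.
Qed.

(** The normal law was defined by its density, and Radon-Nikodym derivatives are
unique up to null sets. *)
Lemma integral_normal_prob (f : measurableTypeR R -> R) : bounded_measurable f ->
  (\int[normal_prob 0 1]_y (f y)%:E = \int[mu]_y (f y * normal_pdf 0 1 y)%:E)%E.
Proof.
move=> bf; have mf := bf.1.
have dom := @normal_prob_dominates R 0 1.
have fi := bounded_measurable_integrable (normal_prob 0 1) bf.
rewrite -(Radon_Nikodym_change_of_variables dom measurableT fi).
pose nu := charge_of_finite_measure (normal_prob (0:R) 1).
have dnu : nu `<< mu by exact: dom.
have iRN := Radon_Nikodym_integrable dnu.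
apply: ae_eq_integral => //.
- by apply: emeasurable_funM; [exact/measurable_EFinP|exact: measurable_int iRN].
- by apply/measurable_EFinP/measurable_funM => //; exact: measurable_normal_pdf.
- under [X in ae_eq _ _ _ X]eq_fun do rewrite EFinM.
  apply: ae_eqe_mul2l; apply: integral_ae_eq => //.
    by apply/measurable_EFinP; exact: measurable_normal_pdf.
  by move=> E _ mE; rewrite -(Radon_Nikodym_integral dnu).
Qed.

Lemma charfun_normal (b s : R) :
  (\int[normal_prob 0 1]_y (cos (s * y + b))%:E = (cos b * expR (- (s ^+ 2 / 2)))%:E)%E.
Proof.
rewrite integral_normal_prob; last first.
  by split; [apply: continuous_measurable_fun; exact: continuous_cosl|
    exists 1 => y; exact: cos_le1_norm].
have n1 : 1 != 0 :> R by rewrite oner_eq0.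
have e t : (\int[mu]_y (cos (t * y + b) * normal_pdf 0 1 y)%:E = (normal_peak 1 * J b t)%:E)%E.
  rewrite EFinM /J /Rintegral fineK; last first.
    by apply: integrable_fin_num => //; exact: integrable_cos_phi.
  rewrite -integralZl//; last exact: integrable_cos_phi; apply: eq_integral => y _.
  by rewrite normal_pdfE// -phi_normal -EFinM; congr EFin; ring.
have J0 : normal_peak 1 * J b 0 = cos b.
  apply: EFin_inj; rewrite -e.
  under eq_integral => y _ do rewrite mul0r add0r EFinM.
  by rewrite integralZl ?integral_normal_pdf ?mule1//; exact: integrable_normal_pdf.
by rewrite e JE mulrA J0.
Qed.

End CharacteristicFunction.

(** The measure normal_prob lives on a copy of R with its own display; this
transports its characteristic function to laws of random variables. *)
Lemma charfun_standard_normal (R : realType) (mu : probability R R) :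
  (forall A, measurable A -> mu A = normal_prob 0 1 A) ->
  forall b s : R, (\int[mu]_y (cos (s * y + b))%:E =
    (cos b * expR (- (s ^+ 2 / 2)))%:E)%E.
Proof.
move=> muE b s; rewrite -charfun_normal.
have mid : measurable_fun setT (id : measurableTypeR R -> R).
  by move=> _ A mA; rewrite setTI; exact: mA.
have mc : measurable_fun setT (fun y : R => cos (s * y + b)).
  apply: (@measurableT_comp _ _ _ _ _ _ cos).
    exact: continuous_measurable_fun (@continuous_cos R).
  by apply: measurable_funD => //; apply: measurable_funM.
have ic : (normal_prob 0 1).-integrable setT ((fun y : R => (cos (s * y + b))%:E) \o id).
  apply: (bounded_measurable_integrable (normal_prob 0 1)).
  by split=> //; exists 1 => y; rewrite ler_norml cos_geN1 cos_le1.
apply: etrans (integral_pushforward mid (D := setT) _ ic measurableT).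
  by apply: eq_measure_integral => A mA _; exact: muE.
exact/measurable_EFinP.
Qed.

(** * Independence of linear combinations *)

Section Independence.
Context d (T : measurableType d) (R : realType) (P : probability T R).

(** Both sides are finite measures in D, and rectangles are a generating class
stable under intersection. *)
Lemma rectangles_generate_joint_events (X Y : {RV P >-> R}) (V : set T) :
  measurable V ->
  (forall A B, measurable A -> measurable B ->
    P ((X @^-1` A `&` Y @^-1` B) `&` V) = P (X @^-1` A `&` Y @^-1` B) * P V)%E ->
  forall D : set (R * R), measurable D ->
    (P ([set w | D (X w, Y w)] `&` V) = P [set w | D (X w, Y w)] * P V)%E.
Proof.
move=> mV rect D mD.
have mXY : measurable_fun setT (fun w => (X w, Y w)) by exact: measurable_fun_pair.
pose XY : {mfun T >-> (R * R)%type} := mfun_Sub (mem_set mXY).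
have PV0 : 0 <= fine (P V) by rewrite fine_ge0.
pose m2 := mscale (NngNum PV0) (distribution P XY).
have m2E A : m2 A = (P (XY @^-1` A) * P V)%E.
  by rewrite /m2 /mscale/= fineK ?fin_num_measure// muleC.
suff : pushforward (mrestr P mV) XY D = m2 D by rewrite m2E.
pose G : set (set (R * R)) := [set A `*` B | A in measurable & B in measurable].
apply: (measure_unique G (fun=> setT) _ _ _ _ (pushforward (mrestr P mV) XY) m2) => //.
- exact: measurable_prod_measurableType.
- move=> _ _ [A1 mA1 [B1 mB1 <-]] [A2 mA2 [B2 mB2 <-]].
  exists (A1 `&` A2); first exact: measurableI.
  by exists (B1 `&` B2); [exact: measurableI|rewrite setXI].
- by move=> _; exists setT => //; exists setT => //; rewrite setXTT.
- by rewrite bigcup_const//; exists 0%N.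
- by move=> _ [A mA [B mB <-]]; apply: etrans (esym (m2E _)); exact: rect.
- move=> _; change (P (setT `&` V) < +oo)%E.
  by rewrite setTI ltey_eq fin_num_measure.
Qed.

Lemma joint_law_product (X Y : {RV P >-> R}) :
  (forall A B, measurable A -> measurable B ->
    P (X @^-1` A `&` Y @^-1` B) = P (X @^-1` A) * P (Y @^-1` B))%E ->
  forall D : set (R * R), measurable D ->
    ((distribution P X \x distribution P Y) D = P [set w | D (X w, Y w)])%E.
Proof.
move=> ind D mD.
have mXY : measurable_fun setT (fun w => (X w, Y w)) by exact: measurable_fun_pair.
pose XY : {mfun T >-> (R * R)%type} := mfun_Sub (mem_set mXY).
rewrite (@product_measure_unique _ _ _ _ _ _ _ (distribution P XY))//.
Qed.

Variables (I : choiceType) (x : I -> {RV P >-> R}).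
Implicit Types (s t : seq I) (a : I -> R).

Definition lincomb s a (w : T) : R := \sum_(i <- s) a i * x i w.

Lemma measurable_lincomb s a : measurable_fun setT (lincomb s a).
Proof.
by apply: measurable_sum => i; apply: measurable_funM => //; exact: measurable_funP.
Qed.

HB.instance Definition _ s a := isMeasurableFun.Build _ _ _ _ (lincomb s a)
  (measurable_lincomb s a).

Hypothesis x_indep : mutually_independent x.

(** Induction on s. Once the event on t and the previous combination are known to
be jointly independent of x k, the pair (previous combination, x k) is independent
of the event on t: this is checked on rectangles, where it is the induction
hypothesis for k :: t, and it passes to the set of pairs (u, v) with a k * v + u in B,
which is the event on the new combination. *)
Lemma lincomb_indep s t a (A : I -> set R) (B : set R) : uniq (s ++ t) ->
  measurable B -> (forall i, i \in t -> measurable (A i)) ->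
  (P (lincomb s a @^-1` B `&` \bigcap_(i in [set` t]) (x i @^-1` A i)) =
   P (lincomb s a @^-1` B) * P (\bigcap_(i in [set` t]) (x i @^-1` A i)))%E.
Proof.
elim: s t A B => [|k s IH] t A B /= ust mB mA.
  have [h|h] : lincomb [::] a @^-1` B = setT \/ lincomb [::] a @^-1` B = set0.
    have [B0|B0] := pselect (B 0); [left|right]; apply/seteqP; split => // w;
      by rewrite /lincomb/= big_nil.
  - by rewrite h setTI probability_setT mul1e.
  - by rewrite h set0I measure0 mul0e.
have /andP[kst ust'] := ust.
have kt : k \notin t by apply: contra kst; rewrite mem_cat => ->; rewrite orbT.
set V := \bigcap_(i in _) _.
have mV : measurable V.
  apply: fin_bigcap_measurable => [|i it]; first exact: finite_seq.
  by rewrite -[X in measurable X]setTI; apply: measurable_funP => //; exact: mA.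
have joint := @rectangles_generate_joint_events
  (lincomb s a) (x k) V mV _ [set y | B (a k * y.2 + y.1)].
have eB : [set w | B (a k * (x k) w + (lincomb s a) w)] = lincomb (k :: s) a @^-1` B.
  by apply/seteqP; split => w /=; rewrite /lincomb big_cons.
move: joint; rewrite /= eB; apply; last first.
  have mf : measurable_fun [set: R * R] (fun y => a k * y.2 + y.1).
    apply: measurable_funD; last exact: measurable_fst.
    by apply: measurable_funM => //; exact: measurable_snd.
  by rewrite -[X in measurable X]setTI; exact: mf.
move=> C D mC mD.
pose A' i := if i == k then D else A i.
have bigA' : \bigcap_(i in [set` k :: t]) (x i @^-1` A' i) = x k @^-1` D `&` V.
  have -> : [set` k :: t] = k |` [set` t].
    apply/seteqP; split => i /=; rewrite inE.
      by move=> /orP[/eqP ->|it]; [left|right].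
    by case=> [->|it]; rewrite ?eqxx// (it : i \in t) orbT.
  rewrite bigcap_setU1 /A' eqxx; congr (_ `&` _).
  apply: eq_bigcapr => i /= it; case: eqVneq => // ik.
  by move: kt; rewrite -ik it.
have mA' i : i \in k :: t -> measurable (A' i).
  by rewrite inE /A'; case: eqVneq => //= _; exact: mA.
have perm : uniq (s ++ k :: t).
  move: ust' kst; rewrite !cat_uniq mem_cat negb_or => /and3P[us h ut] /andP[ks _].
  by rewrite /= us negb_or ks h kt.
have := IH (k :: t) A' C perm mC mA'.
rewrite bigA' setIA => ->.
have h1 : (P (x k @^-1` D `&` V) = P (x k @^-1` D) * P V)%E.
  rewrite -bigA' x_indep//; last first.
    by have := perm; rewrite cat_uniq => /and3P[].
  rewrite big_cons {1}/A' eqxx x_indep//; last first.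
    by have := ust'; rewrite cat_uniq => /and3P[].
  congr (_ * _)%E; apply: eq_big_seq => i it.
  by rewrite /A'; case: eqVneq => // ik; move: kt; rewrite -ik it.
have h2 : (P (lincomb s a @^-1` C `&` x k @^-1` D) =
    P (lincomb s a @^-1` C) * P (x k @^-1` D))%E.
  have := IH [:: k] (fun=> D) C _ mC _.
  have -> : \bigcap_(i in [set` [:: k]]) (x i @^-1` D) = x k @^-1` D.
    by rewrite set_cons1 bigcap_set1.
  apply => //.
  by move: perm; rewrite -cat_rcons cat_uniq => /andP[+ _]; rewrite -cats1.
by rewrite h1 h2 muleA.
Qed.

End Independence.

(** * Characteristic functions of linear combinations *)

Section GaussianLinearForms.
Context d (T : measurableType d) (R : realType) (P : probability T R).

Lemma integral_joint_law (X Y : {RV P >-> R}) (f : R * R -> R) :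
  (forall A B, measurable A -> measurable B ->
    P (X @^-1` A `&` Y @^-1` B) = P (X @^-1` A) * P (Y @^-1` B))%E ->
  bounded_measurable f ->
  (\int[P]_w (f (X w, Y w))%:E =
   \int[distribution P X]_u \int[distribution P Y]_v (f (u, v))%:E)%E.
Proof.
move=> ind bf.
have mXY : measurable_fun setT (fun w => (X w, Y w)) by exact: measurable_fun_pair.
pose XY : {RV P >-> (R * R)%type} := mfun_Sub (mem_set mXY).
have mf : measurable_fun setT (EFin \o f) by apply/measurable_EFinP; case: bf.
have ifXY : P.-integrable setT ((EFin \o f) \o XY).
  exact: bounded_measurable_integrable (bounded_measurable_comp mXY bf).
rewrite -[LHS](integral_distribution mf ifXY).
have ifp : (distribution P X \x distribution P Y)%E.-integrable setT (EFin \o f).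
  case: bf => _ [M fM]; apply: measurable_bounded_integrable => //.
  - have e := joint_law_product ind (@measurableT _ (R * R)%type).
    apply: (@eq_ind_r _ _ (fun z => z < +oo)%E _ _ e).
    by change (P setT < +oo)%E; rewrite probability_setT ltry.
  - exact/measurable_EFinP.
  - by exists M; split => [|x Mx y _]; [exact: num_real|exact: le_trans (fM y) (ltW Mx)].
apply: etrans; last exact: esym (integral12_prod_meas1 ifp).
apply: eq_measure_integral => D mD _.
exact: esym (joint_law_product ind mD).
Qed.

Variables (I : choiceType) (x : I -> {RV P >-> R}).
Hypothesis x_indep : mutually_independent x.
Hypothesis x_normal : forall i, standard_normal (x i).

(** Induction on s, integrating out one variable at a time. The phase b is what
makes the induction go through: it absorbs the contribution of the others. *)
Lemma charfun_lincomb (s : seq I) (a : I -> R) (b : R) : uniq s ->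
  (\int[P]_w (cos (b + lincomb x s a w))%:E =
   (cos b * expR (- ((\sum_(i <- s) a i ^+ 2) / 2)))%:E)%E.
Proof.
elim: s b => [|k s IH] b /=.
  move=> _; rewrite big_nil mul0r oppr0 expR0 mulr1.
  under eq_integral do rewrite /lincomb big_nil addr0.
  by rewrite integral_cst//= probability_setT mule1.
move=> /andP[ks us].
transitivity (\int[P]_w (cos (a k * x k w + (b + lincomb x s a w)))%:E)%E.
  by apply: eq_integral => w _; rewrite /lincomb big_cons addrCA.
pose f (z : R * R) := cos (a k * z.2 + (b + z.1)).
rewrite [LHS](@integral_joint_law (lincomb x s a) (x k) f); last 2 first.
- move=> A B mA mB; have := @lincomb_indep _ _ _ P _ x x_indep s [:: k] a (fun=> B) A.
  rewrite set_cons1 bigcap_set1; apply => //.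
  by rewrite cats1 rcons_uniq ks.
- apply: bounded_measurable_cos; apply: measurable_funD.
    by apply: measurable_funM => //; exact: measurable_snd.
  by apply: measurable_funD => //; exact: measurable_fst.
transitivity (\int[distribution P (lincomb x s a)]_u
    ((expR (- (a k ^+ 2 / 2)))%:E * (cos (b + u))%:E))%E.
  apply: eq_integral => u _; rewrite /f/=.
  by rewrite charfun_standard_normal -?EFinM 1?mulrC// => A; exact: x_normal.
have bc : bounded_measurable (fun u : R => cos (b + u)).
  by apply: bounded_measurable_cos; exact: measurable_funD.
rewrite integralZl//; last exact: bounded_measurable_integrable bc.
rewrite integral_distribution; last 2 first.
- by apply/measurable_EFinP; case: bc.
- apply: (@bounded_measurable_integrable _ _ _ P (fun w => cos (b + lincomb x s a w))).
  by apply: bounded_measurable_cos; apply: measurable_funD => //; exact: measurable_lincomb.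
rewrite [X in (_ * X)%E](_ : _ = \int[P]_w (cos (b + lincomb x s a w))%:E)%E//.
rewrite IH// -EFinM big_cons mulrCA -expRD; congr (_ * expR _)%:E; by field.
Qed.

End GaussianLinearForms.

(** * Gaussian weights of orthonormal linear forms *)

Section GaussianBall.
Context d (T : measurableType d) (R : realType) (P : probability T R).
Variables (I : choiceType) (x : I -> {RV P >-> R}).
Hypothesis x_indep : mutually_independent x.
Hypothesis x_normal : forall i, standard_normal (x i).

(** Named because the integrands in integral_cos_weights are signed: the induction
there needs the exact mean, and the bound sqrt t only comes in at the end. *)
Definition gauss_const (t : R) : R := fine (\int[normal_prob 0 1]_g (gauss_weight t g)%:E).

Lemma gauss_const_ge0 t : 0 <= gauss_const t.
Proof.
by apply: fine_ge0; apply: integral_ge0 => g _; rewrite lee_fin expR_ge0.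
Qed.

Lemma integral_gauss_weight t : 0 < t ->
  (\int[normal_prob 0 1]_g (gauss_weight t g)%:E = (gauss_const t)%:E)%E.
Proof.
move=> t0; rewrite fineK//; apply: integrable_fin_num => //.
apply: (bounded_measurable_integrable (normal_prob 0 1)).
exact: bounded_measurable_weight.
Qed.

(** Bound the standard normal density by its peak; what remains is a multiple of
the normal density of variance t. *)
Lemma gauss_const_le t : 0 < t -> gauss_const t <= Num.sqrt t.
Proof.
move=> t0; rewrite -lee_fin -integral_gauss_weight//.
have bw := @bounded_measurable_weight R _ (measurableTypeR R) id t t0 (@measurable_id _ _ _).
have mw := bw.1; rewrite integral_normal_prob//.
have st0 : Num.sqrt t != 0 by rewrite gt_eqF// sqrtr_gt0.
have pe : normal_peak 1 = Num.sqrt t * normal_peak (Num.sqrt t).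
  rewrite /normal_peak expr1n mul1r sqr_sqrtr ?ltW// -mulrnAr (sqrtrM _ (ltW t0)).
  by rewrite invfM mulrA divff// mul1r.
apply: (@le_trans _ _ (\int[@lebesgue_measure R]_y
   ((Num.sqrt t)%:E * (normal_pdf 0 (Num.sqrt t) y)%:E))%E); last first.
  by rewrite integralZl ?integral_normal_pdf ?mule1//; exact: integrable_normal_pdf.
apply: ge0_le_integral => //.
- by move=> y _; rewrite lee_fin mulr_ge0 ?expR_ge0// normal_pdf_ge0.
- by apply/measurable_EFinP/measurable_funM => //; exact: measurable_normal_pdf.
- by apply/measurable_EFinP/measurable_funM => //; exact: measurable_normal_pdf.
move=> y _; rewrite -EFinM lee_fin !normal_pdfE ?oner_eq0// pe.
have -> : gauss_weight t y = normal_fun 0 (Num.sqrt t) y.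
  by rewrite /gauss_weight /normal_fun subr0 sqr_sqrtr ?ltW// -(mulr_natl t 2) mulNr.
set b := normal_fun 0 (Num.sqrt t) y; set c := normal_fun 0 1 y.
set q := normal_peak (Num.sqrt t).
rewrite (_ : b * (Num.sqrt t * q * c) = Num.sqrt t * (q * b) * c); last by ring.
apply: ler_piMr.
  by rewrite !mulr_ge0 ?sqrtr_ge0 ?normal_peak_ge0 ?expR_ge0.
rewrite /c /normal_fun subr0 expr1n -[leRHS]expR0 ler_expR mulNr oppr_le0.
by rewrite divr_ge0 ?sqr_ge0.
Qed.

Variables (s : seq I) (us : uniq s).
Local Notation L := (lincomb x s).

Definition inner (a b : I -> R) : R := \sum_(i <- s) a i * b i.

Lemma inner_lineD (a u v : I -> R) (c : R) :
  inner (fun i => a i + c * u i) v = inner a v + c * inner u v.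
Proof.
by rewrite /inner mulr_sumr -big_split/=; apply: eq_bigr => i _; rewrite mulrDl mulrA.
Qed.

Lemma innerC (u v : I -> R) : inner u v = inner v u.
Proof. by apply: eq_bigr => i _; rewrite mulrC. Qed.

Lemma lincomb_lineD (a u : I -> R) (c : R) w :
  L (fun i => a i + c * u i) w = L a w + c * L u w.
Proof.
by rewrite /lincomb mulr_sumr -big_split/=; apply: eq_bigr => i _; rewrite mulrDl mulrA.
Qed.

Variables (J : eqType) (U : J -> I -> R) (t : R).
Hypothesis t0 : 0 < t.

Lemma bounded_measurable_weights (js : seq J) :
  bounded_measurable (fun w => \prod_(j <- js) gauss_weight t (L (U j) w)).
Proof.
elim: js => [|j js IH].
  under eq_fun do rewrite big_nil.
  by split => //; exists 1 => w; rewrite normr1.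
under eq_fun do rewrite big_cons.
by apply: bounded_measurableM => //; exact: bounded_measurable_weight.
Qed.

(** Orthonormal linear forms of independent standard normal variables are
independent standard normal; this is the instance needed. Each weight
exp (- y ^ 2 / (2 t)) is the average of cos (g y / sqrt t) over a standard normal g.
Exchanging the two integrations and linearizing the product of cosines replaces
the vector a by a + (g / sqrt t) U_j and a - (g / sqrt t) U_j, which remain orthogonal
to the other U_k, so that the induction on js applies under the integral in g. *)
Lemma integral_cos_weights (js : seq J) (a : I -> R) : uniq js ->
  (forall j k, j \in js -> k \in js -> inner (U j) (U k) = (j == k)%:R) ->
  (forall j, j \in js -> inner a (U j) = 0) ->
  (\int[P]_w (cos (L a w) * \prod_(j <- js) gauss_weight t (L (U j) w))%:E =
   (expR (- (inner a a / 2)) * gauss_const t ^+ size js)%:E)%E.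
Proof.
elim: js a => [|j js IH] a /=.
  move=> _ _ _.
  under eq_integral => w _ do rewrite big_nil mulr1 -[L a w]add0r.
  rewrite charfun_lincomb// cos0 mul1r mulr1.
  by rewrite (_ : \sum_(i <- s) a i ^+ 2 = inner a a)//; apply: eq_bigr => i _; rewrite expr2.
move=> /andP[jjs ujs] orth aU.
pose W w := \prod_(k <- js) gauss_weight t (L (U k) w).
have bW : bounded_measurable W := bounded_measurable_weights js.
have bc b : bounded_measurable (fun w => cos (L b w) * W w).
  apply: bounded_measurableM => //; apply: bounded_measurable_cos.
  exact: measurable_lincomb.
pose st := Num.sqrt t.
have st0 : st != 0 by rewrite gt_eqF// sqrtr_gt0.
have st2 : st ^+ 2 = t by rewrite sqr_sqrtr// ltW.
pose F (z : T * measurableTypeR R) : R := cos (L a z.1) * W z.1 * cos (z.2 * (L (U j) z.1 / st)).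
have bF : bounded_measurable F.
  apply: bounded_measurableM.
    exact: (bounded_measurable_comp (@measurable_fst _ _ _ _) (bc a)).
  apply: bounded_measurable_cos; apply: measurable_funM; first exact: measurable_snd.
  apply: measurable_funM => //.
  apply: (measurableT_comp (measurable_lincomb x s (U j))).
  exact: measurable_fst.
have iF : (P \x normal_prob 0 1)%E.-integrable setT (EFin \o F).
  case: bF => mF [M FM]; apply: measurable_bounded_integrable => //.
    have := product_measure1E P (normal_prob (0:R) 1) (A1 := setT) (A2 := setT)
      measurableT measurableT.
    rewrite setXTT => e; apply: (@eq_ind_r _ _ (fun z => z < +oo)%E _ _ e).
    by rewrite lte_mul_pinfty// ?fin_num_measure// ltey_eq fin_num_measure.
  by exists M; split => [|y My z _]; [exact: num_real|exact: le_trans (FM z) (ltW My)].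
transitivity (\int[P]_w \int[normal_prob 0 1]_g (F (w, g))%:E)%E.
  apply: eq_integral => w _; rewrite big_cons /F/=.
  under eq_integral => g _ do rewrite EFinM.
  rewrite integralZl//; last first.
    apply: (bounded_measurable_integrable (normal_prob 0 1)).
    by apply: bounded_measurable_cos; exact: measurable_funM.
  have -> : (\int[normal_prob 0 1]_g (cos (g * (L (U j) w / st)))%:E =
      (cos 0 * expR (- ((L (U j) w / st) ^+ 2 / 2)))%:E)%E.
    by rewrite -charfun_normal; apply: eq_integral => g _; rewrite addr0 mulrC.
  rewrite -EFinM cos0 mul1r; congr EFin.
  have -> : expR (- ((L (U j) w / st) ^+ 2 / 2)) = gauss_weight t (L (U j) w).
    by rewrite /gauss_weight expr_div_n st2 -mulrA invfM [t^-1 * _]mulrC.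
  by rewrite /W; ring.
rewrite [LHS](Fubini iF)/=.
have inn (c : R) b : b ^+ 2 = 1 ->
  inner (fun i => a i + (b * c) * U j i) (fun i => a i + (b * c) * U j i) = inner a a + c ^+ 2.
  move=> b2; pose v i := a i + (b * c) * U j i.
  have vR z : inner v z = inner a z + b * c * inner (U j) z by exact: inner_lineD.
  rewrite -/v vR (innerC a v) (innerC (U j) v) !vR (innerC (U j) a).
  rewrite aU ?mem_head// orth ?mem_head// eqxx.
  by rewrite mulr0 addr0 add0r mulr1 -expr2 exprMn b2 mul1r.
have IHc (c b : R) : b ^+ 2 = 1 ->
  (\int[P]_w (cos (L (fun i => a i + (b * c) * U j i) w) * W w)%:E =
    (expR (- ((inner a a + c ^+ 2) / 2)) * gauss_const t ^+ size js)%:E)%E.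
  move=> b2; rewrite -(inn c b b2) IH//.
    by move=> k l kjs ljs; apply: orth; rewrite inE ?kjs ?ljs orbT.
  move=> k kjs; rewrite inner_lineD aU ?inE ?kjs ?orbT// orth ?mem_head ?inE ?kjs ?orbT//.
  by case: eqVneq => [jk|]; [move: jjs; rewrite jk kjs|rewrite mulr0 addr0].
transitivity (\int[normal_prob 0 1]_g
   ((expR (- (inner a a / 2)) * gauss_const t ^+ size js)%:E * (gauss_weight t g)%:E))%E.
  apply: eq_integral => g _.
  transitivity (\int[P]_w ((2^-1)%:E * (cos (L (fun i => a i + (1 * (g / st)) * U j i) w) * W w)%:E
       + (2^-1)%:E * (cos (L (fun i => a i + (-1 * (g / st)) * U j i) w) * W w)%:E))%E.
    apply: eq_integral => w _; rewrite -!EFinM -EFinD; congr EFin.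
    rewrite !lincomb_lineD mulN1r mul1r mulNr cosB cosD /F/=.
    by rewrite (_ : g * (L (U j) w / st) = g / st * L (U j) w); [field|ring].
  rewrite integralD//; last 2 first.
    by apply: integrableZl => //; exact: bounded_measurable_integrable (bc _).
    by apply: integrableZl => //; exact: bounded_measurable_integrable (bc _).
  rewrite !integralZl//; try exact: bounded_measurable_integrable (bc _).
  rewrite !IHc ?expr1n ?sqrrN ?expr1n// -!EFinM -EFinD; congr EFin.
  rewrite /gauss_weight [RHS]mulrAC -expRD.
  rewrite (_ : - (inner a a / 2) + _ = - ((inner a a + (g / st) ^+ 2) / 2)); first by field.
  rewrite expr_div_n st2; field; exact: lt0r_neq0.
rewrite integralZl//; last first.
  by apply: (bounded_measurable_integrable (normal_prob 0 1)); exact: bounded_measurable_weight.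
by rewrite integral_gauss_weight// -EFinM exprSr mulrA.
Qed.

Lemma integral_weights_le (js : seq J) : uniq js ->
  (forall j k, j \in js -> k \in js -> inner (U j) (U k) = (j == k)%:R) ->
  (\int[P]_w (\prod_(j <- js) gauss_weight t (L (U j) w))%:E <=
   (Num.sqrt t ^+ size js)%:E)%E.
Proof.
move=> ujs orth.
have inner0 v : inner (fun=> 0) v = 0 by rewrite /inner big1// => i _; rewrite mul0r.
have := @integral_cos_weights js (fun=> 0) ujs orth (fun j _ => inner0 _).
rewrite inner0 mul0r oppr0 expR0 mul1r.
under eq_integral => w _.
  rewrite [L _ w](_ : _ = 0); last by rewrite /lincomb big1// => i _; rewrite mul0r.
  rewrite cos0 mul1r; over.
move=> ->; rewrite lee_fin lerXn2r ?nnegrE ?gauss_const_ge0 ?sqrtr_ge0//.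
exact: gauss_const_le.
Qed.

End GaussianBall.

(** * Weak frequencies *)

Section Deterministic.
Variables (R : realType) (p' n' : nat).
Local Notation p := p'.+1.
Local Notation n := n'.+1.
Hypothesis pn : (p <= n)%N.
Implicit Types (k l : 'I_n) (v : 'rV[R]_p).
Local Notation hartley := (@hartley R n' _).

Definition samples (a : int -> R) : 'I_n -> R := fun k => a (k : nat)%:Z.
Definition covariance_of (a : int -> R) : 'M[R]_p :=
  sample_covariance (@rect_circulant R p n a).

Lemma rect_circulantE (a : int -> R) (i : 'I_p) (j : 'I_n) :
  @rect_circulant R p n a i j = samples a (j - inZp i).
Proof.
have ilt : (i < n)%N by exact: leq_trans (ltn_ord i) pn.
rewrite mxE /samples /= modnDmr (modn_small ilt); congr a.
rewrite -modz_nat PoszD -subzn 1?ltnW// addrA addrAC.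
by rewrite modzDr.
Qed.

Lemma covariance_sym (a : int -> R) : (covariance_of a)^T = covariance_of a.
Proof. by rewrite /covariance_of /sample_covariance linearZ/= trmx_mul trmxK. Qed.

Lemma form_covariance (a : int -> R) v :
  form (covariance_of a) v v =
  n%:R ^- 2 * \sum_(k : 'I_n) power (samples a) k * hartley (v 0) k ^+ 2.
Proof.
rewrite -cyclic_conv_energy mulrA -exprVn (expr2 n%:R^-1) -(mulrA n%:R^-1) mulVf ?pnatr_eq0// mulr1.
rewrite /form /covariance_of /sample_covariance -scalemxAr -scalemxAl mxE; congr (_ * _).
set M := rect_circulant _ _ _.
rewrite mulmxA -[_ *m M^T *m _]mulmxA -trmx_mul mxE; apply: eq_bigr => j _.
rewrite [X in _ * X]mxE -expr2; congr (_ ^+ 2).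
by rewrite mxE; apply: eq_bigr => i _; rewrite /M rect_circulantE.
Qed.

Variable (tau : R).
Hypothesis tau0 : 0 < tau.

(** Frequencies at which the sample has too little power. A vector makes the
quadratic form small only by concentrating its spectrum there. *)
Definition weak (a : int -> R) : pred 'I_n := fun k => power (samples a) k < n%:R * tau.

(** Keep only the strong frequencies; Parseval turns the bound on the weak part
of the spectrum into a lower bound on the strong part. *)
Lemma form_ge_weak (a : int -> R) v (B : R) :
  \sum_(k | weak a k) hartley (v 0) k ^+ 2 <= B * normsq v ->
  tau * (1 - B / n%:R) * normsq v <= form (covariance_of a) v v.
Proof.
move=> hB; have n0 : 0 < n%:R :> R by [].
rewrite form_covariance ler_pdivlMl ?exprn_gt0//.
have pars := parseval_hartley (v 0) pn.
rewrite (bigID (weak a))/= in pars.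
have -> : n%:R ^+ 2 * (tau * (1 - B / n%:R) * normsq v) =
    n%:R * tau * (n%:R * normsq v - B * normsq v).
  by field.
rewrite (bigID (weak a))/= ler_wpDl//.
  apply: sumr_ge0 => k _; rewrite mulr_ge0 ?sqr_ge0//.
  by rewrite addr_ge0 ?sqr_ge0.
apply: (@le_trans _ _ (n%:R * tau * \sum_(k | ~~ weak a k) hartley (v 0) k ^+ 2)).
  rewrite ler_wpM2l ?mulr_ge0 ?(ltW tau0)// -/(normsq v).
  by move: pars hB; rewrite -/(normsq v); lra.
rewrite mulr_sumr; apply: ler_sum => k; rewrite -leNgt => wk.
by rewrite ler_wpM2r ?sqr_ge0.
Qed.

(** A smooth majorant, up to a constant, of the indicator of a small Hartley
coefficient. The normalized coefficient hartley / sqrt n is standard normal. *)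
Definition freq_weight (a : int -> R) k : R :=
  gauss_weight tau (hartley (samples a) k / Num.sqrt n%:R).

Lemma freq_weightE (a : int -> R) k :
  freq_weight a k = expR (- (hartley (samples a) k ^+ 2 / (2 * (n%:R * tau)))).
Proof.
rewrite /freq_weight /gauss_weight expr_div_n sqr_sqrtr//; congr (expR (- _)).
by rewrite -mulrA -invfM mulrCA.
Qed.

Lemma freq_weight_ge0 (a : int -> R) k : 0 <= freq_weight a k.
Proof. exact: expR_ge0. Qed.

(** On a weak frequency the exponents of the two weights add up to at least - 1. *)
Lemma weak_weight (a : int -> R) k : weak a k ->
  1 <= expR 1 * (freq_weight a k * freq_weight a (- k)).
Proof.
rewrite /weak powerE !freq_weightE => wk; rewrite -!expRD -[leLHS]expR0 ler_expR.
have nt : 0 < n%:R * tau by rewrite mulr_gt0.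
rewrite -opprD -mulrDl subr_ge0 ler_pdivrMr ?mulr_gt0//.
by rewrite mul1r; move: wk; lra.
Qed.

Lemma weak_weight_self (a : int -> R) k : - k = k -> weak a k ->
  1 <= expR 1 * freq_weight a k.
Proof.
rewrite /weak powerE freq_weightE => -> wk; rewrite -expRD -[leLHS]expR0 ler_expR.
have nt : 0 < n%:R * tau by rewrite mulr_gt0.
rewrite subr_ge0 ler_pdivrMr ?mulr_gt0//.
by rewrite mul1r; move: wk nt; lra.
Qed.

(** Together with 0, the only candidate for a frequency equal to its opposite. For
odd n it is an ordinary frequency; taking it for every n avoids a case on parity. *)
Definition nyquist : 'I_n := inZp n./2.

Lemma self_opp k : - k = k -> k = 0 \/ k = nyquist.
Proof.
move=> /(congr1 val)/= h; have kn := ltn_ord k.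
have [k0|k0] := posnP k; [left|right]; apply: val_inj => //=.
move: h; rewrite modn_small; last by rewrite ltn_subrL k0.
move=> h; have e : n = k.*2 by rewrite -addnn -{1}h subnK// ltnW.
have /= e2 : n./2 = k := etrans (congr1 half e) (doubleK k).
by rewrite e2 modn_small.
Qed.

(** A frequency with k = - k carries a single normal coefficient, so it is weak
with probability of order sqrt tau rather than tau. There are at most two, and they
are required to be strong. *)
Definition self_penalty (a : int -> R) : R :=
  expR 1 * (freq_weight a 0 + freq_weight a nyquist).

Lemma self_penalty_ge0 a : 0 <= self_penalty a.
Proof. by rewrite mulr_ge0 ?expR_ge0// addr_ge0 ?freq_weight_ge0. Qed.

Lemma weak_not_self (a : int -> R) k : self_penalty a < 1 -> weak a k -> - k != k.
Proof.
move=> sb wk; apply/eqP => /[dup] kk /self_opp k0.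
have := lt_le_trans sb (weak_weight_self kk wk).
rewrite /self_penalty ltr_pM2l ?expR_gt0// => h.
by case: k0 => k0; move: h; rewrite k0; apply/negP; rewrite -leNgt;
  rewrite ?lerDl ?lerDr freq_weight_ge0.
Qed.

(** Dominates the indicator of the existence of a weak frequency. *)
Definition single_penalty (a : int -> R) : R :=
  self_penalty a + \sum_(k | - k != k) expR 1 * (freq_weight a k * freq_weight a (- k)).

Lemma form_ge_single (a : int -> R) v : single_penalty a < 1 ->
  tau * normsq v <= form (covariance_of a) v v.
Proof.
move=> sb.
have S0 : 0 <= \sum_(k | - k != k) expR 1 * (freq_weight a k * freq_weight a (- k)).
  by apply: sumr_ge0 => k _; rewrite !mulr_ge0 ?expR_ge0.
have nweak k : ~~ weak a k.
  apply/negP => wk; have selfk := @weak_not_self a k _ wk.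
  have {}selfk : - k != k.
    by apply: selfk; apply: le_lt_trans sb; rewrite /single_penalty lerDl.
  move: sb; apply/negP; rewrite -leNgt (le_trans (weak_weight wk))//.
  rewrite /single_penalty ler_wpDl ?self_penalty_ge0// (bigD1 k)//= lerDl.
  by apply: sumr_ge0 => l _; rewrite !mulr_ge0 ?expR_ge0.
have := @form_ge_weak a v 0; rewrite !mul0r subr0 mulr1; apply.
by rewrite big1// => k wk; move: (nweak k); rewrite wk.
Qed.

(** The four frequencies k, - k, l, - l are distinct, hence their coefficients are
independent. *)
Definition apart k l := [&& - k != k, - l != l, l != k & l != - k].

(** Besides the self-opposite frequencies, dominates F ^ 2 / (eta n) ^ 2 where F is
the Frobenius norm in the large sieve for the set of weak frequencies. *)
Definition pair_penalty (eta : R) (a : int -> R) : R :=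
  self_penalty a + (eta * n%:R) ^- 2 * \sum_k \sum_(l | apart k l)
    gram R p k l ^+ 2 * (expR 1 ^+ 2 *
      (freq_weight a k * freq_weight a (- k) * (freq_weight a l * freq_weight a (- l)))).

Lemma form_ge_pair (eta : R) (a : int -> R) v : 0 < eta -> pair_penalty eta a < 1 ->
  tau * (1 - 2 * p%:R / n%:R - eta) * normsq v <= form (covariance_of a) v v.
Proof.
move=> eta0 sb; have n0 : 0 < n%:R :> R by [].
have t0 k l : 0 <= gram R p k l ^+ 2 * (expR 1 ^+ 2 *
      (freq_weight a k * freq_weight a (- k) * (freq_weight a l * freq_weight a (- l)))).
  apply: mulr_ge0; first exact: sqr_ge0.
  apply: mulr_ge0; first exact: sqr_ge0.
  by apply: mulr_ge0; apply: mulr_ge0; exact: freq_weight_ge0.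
have en0 : 0 < (eta * n%:R) ^+ 2 by rewrite exprn_gt0// mulr_gt0.
have sself : self_penalty a < 1.
  apply: le_lt_trans sb; rewrite lerDl mulr_ge0 ?invr_ge0 ?(ltW en0)//.
  by apply: sumr_ge0 => k _; apply: sumr_ge0 => l _; exact: t0.
have wself k : weak a k -> - k != k by exact: weak_not_self.
have -> : 1 - 2 * p%:R / n%:R - eta = 1 - (2 * p%:R + eta * n%:R) / n%:R.
  by move: (n%:R : R) n0 => N N0; field; exact: lt0r_neq0.
apply: form_ge_weak; apply: large_sieve => //; first by rewrite mulr_ge0// ltW.
rewrite (@le_trans _ _ (\sum_k \sum_(l | apart k l)
    gram R p k l ^+ 2 * (expR 1 ^+ 2 *
      (freq_weight a k * freq_weight a (- k) * (freq_weight a l * freq_weight a (- l))))))//.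
  apply: ler_sum => k _; rewrite [leLHS]big_mkcond [leRHS]big_mkcond; apply: ler_sum => l _.
  case: ifP => [/and4P[wk wl lk lk']|_]; last by case: ifP.
  rewrite /apart !wself// lk lk'/= ler_peMr ?sqr_ge0//.
  rewrite expr2 mulrACA -[leLHS]mulr1; apply: ler_pM => //; exact: weak_weight.
move: sb; rewrite /pair_penalty -ltrBrDl => /ltW; rewrite ler_pdivrMl// => /le_trans; apply.
by rewrite ler_piMr ?(ltW en0)// gerBl self_penalty_ge0.
Qed.
End Deterministic.

(** * Means of the majorants *)

Section MeanBound.
Context d (T : measurableType d) (R : realType) (P : probability T R).

(** Bundles the measurability and positivity that accompany every bound on a
mean below. *)
Definition mean_le (f : T -> R) (m : R) :=
  [/\ measurable_fun setT f, forall w, 0 <= f w & (\int[P]_w (f w)%:E <= m%:E)%E].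

Lemma mean_leW (f : T -> R) (m1 m2 : R) : m1 <= m2 -> mean_le f m1 -> mean_le f m2.
Proof.
by move=> m12 [mf f0 fm]; split => //; apply: (le_trans fm); rewrite lee_fin.
Qed.

Lemma mean_le0 : mean_le (fun=> 0) 0.
Proof. by split => //; rewrite integral0. Qed.

Lemma mean_leD (f g : T -> R) (m1 m2 : R) : mean_le f m1 -> mean_le g m2 ->
  mean_le (fun w => f w + g w) (m1 + m2).
Proof.
move=> [mf f0 fm] [mg g0 gm]; split.
- exact: measurable_funD.
- by move=> w; rewrite addr_ge0.
under eq_integral do rewrite EFinD.
rewrite ge0_integralD//; first by rewrite EFinD leeD.
- by move=> w _; rewrite lee_fin.
- exact/measurable_EFinP.
- by move=> w _; rewrite lee_fin.
- exact/measurable_EFinP.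
Qed.

Lemma mean_leZ (f : T -> R) (c m : R) : 0 <= c -> mean_le f m ->
  mean_le (fun w => c * f w) (c * m).
Proof.
move=> c0 [mf f0 fm]; split.
- exact: measurable_funM.
- by move=> w; rewrite mulr_ge0.
under eq_integral do rewrite EFinM.
rewrite ge0_integralZl//.
- by rewrite EFinM lee_wpmul2l// lee_fin.
- exact/measurable_EFinP.
- by move=> w _; rewrite lee_fin.
Qed.

Lemma mean_le_sum (I : Type) (r : seq I) (Q : pred I) (f : I -> T -> R) (m : I -> R) :
  (forall i, Q i -> mean_le (f i) (m i)) ->
  mean_le (fun w => \sum_(i <- r | Q i) f i w) (\sum_(i <- r | Q i) m i).
Proof.
move=> h; elim: r => [|i r IH].
  by under eq_fun do rewrite big_nil; rewrite big_nil; exact: mean_le0.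
under eq_fun do rewrite big_cons; rewrite big_cons.
by case: ifP => // Qi; apply: mean_leD => //; exact: h.
Qed.

Lemma markov_event (f : T -> R) (m : R) (E : set T) : mean_le f m -> measurable E ->
  (forall w, E w -> 1 <= f w) -> (P E <= m%:E)%E.
Proof.
move=> [mf f0 fm] mE Ef; apply: le_trans fm.
rewrite -[P E]mul1e -integral_cst//.
apply: (@le_trans _ _ (\int[P]_(w in E) (f w)%:E)%E).
  apply: ge0_le_integral => //.
  by apply/measurable_EFinP; exact: measurable_funTS.
apply: ge0_subset_integral => //.
- exact/measurable_EFinP.
- by move=> w _; rewrite lee_fin.
Qed.

End MeanBound.

Section Probability.
Context d (T : measurableType d) (R : realType) (P : probability T R).
Variable x : int -> {RV P >-> R}.
Hypothesis x_indep : mutually_independent x.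
Hypothesis x_normal : forall i, standard_normal (x i).
Variables (p' n' : nat).
Local Notation p := p'.+1.
Local Notation n := n'.+1.
Hypothesis pn : (p <= n)%N.
Variable tau : R.
Hypothesis tau0 : 0 < tau.

Let a (w : T) (i : int) : R := x i w.
(** The n independent variables and the coefficients of the normalized Hartley
transform, in the indexing by int of the family x. *)
Let s : seq int := [seq (Posz i) | i <- iota 0 n].
Let U (k : 'I_n) (i : int) : R := cas R n' k `|i|%N / Num.sqrt n%:R.

Let lincombU k w : lincomb x s (U k) w = hartley n' (@samples R n' (a w)) k / Num.sqrt n%:R.
Proof.
rewrite /lincomb /s big_map -[iota 0 n]/(index_iota 0 n) big_mkord /hartley mulr_suml.
by apply: eq_bigr => i _; rewrite /U /samples /a /=; ring.
Qed.

Let innerU k l : inner s (U k) (U l) = (k == l)%:R.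
Proof.
rewrite /inner /s big_map -[iota 0 n]/(index_iota 0 n) big_mkord.
transitivity ((\sum_(i < n) cas R n' k i * cas R n' l i) / n%:R).
  rewrite mulr_suml; apply: eq_bigr => i _; rewrite /U /=.
  by rewrite mulrACA -invfM -expr2 sqr_sqrtr.
under eq_bigr => i _ do rewrite (casC _ _ k) (casC _ _ l).
rewrite cas_orth// (_ : (k == l :> nat) = (k == l))//.
by case: eqP => _; rewrite ?mul0r// divff// pnatr_eq0.
Qed.

(** Orthogonality of the Hartley kernel makes the normalized coefficients at
distinct frequencies orthonormal linear forms in the sample. *)
Lemma mean_le_weights (ks : seq 'I_n) : uniq ks ->
  mean_le P (fun w => \prod_(k <- ks) freq_weight tau (a w) k) (Num.sqrt tau ^+ size ks).
Proof.
move=> uks.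
have us : uniq s by rewrite map_inj_uniq ?iota_uniq// => i j [].
have e w : \prod_(k <- ks) freq_weight tau (a w) k =
    \prod_(k <- ks) gauss_weight tau (lincomb x s (U k) w).
  by apply: eq_bigr => k _; rewrite lincombU.
split.
- under eq_fun do rewrite e.
  by have [] := bounded_measurable_weights x s U tau0 ks.
- by move=> w; apply: prodr_ge0 => k _; exact: freq_weight_ge0.
under eq_integral do rewrite e.
by apply: integral_weights_le => // j k _ _; exact: innerU.
Qed.

Let mean_le_weight (k : 'I_n) : mean_le P (fun w => freq_weight tau (a w) k) (Num.sqrt tau).
Proof.
have := @mean_le_weights [:: k] isT; rewrite /= expr1.
by under eq_fun do rewrite big_seq1.
Qed.

Let mean_le_weight2 (k : 'I_n) : - k != k ->
  mean_le P (fun w => freq_weight tau (a w) k * freq_weight tau (a w) (- k)) tau.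
Proof.
move=> kk; have := @mean_le_weights [:: k; - k].
rewrite /= inE eq_sym kk => /(_ isT); rewrite sqr_sqrtr ?ltW//.
by under eq_fun do rewrite big_cons big_seq1.
Qed.

Let mean_le_weight4 (k l : 'I_n) : apart k l ->
  mean_le P (fun w => freq_weight tau (a w) k * freq_weight tau (a w) (- k) *
    (freq_weight tau (a w) l * freq_weight tau (a w) (- l))) (tau ^+ 2).
Proof.
move=> /and4P[kk ll lk lk']; have := @mean_le_weights [:: k; - k; l; - l].
have kl' : (k == - l) = false by rewrite -eqr_oppLR eq_sym (negbTE lk').
rewrite /= !inE eq_sym (negbTE kk) eq_sym (negbTE lk) kl' eq_sym (negbTE lk') eqr_opp.
rewrite eq_sym (negbTE lk) eq_sym ll => /(_ isT).
rewrite -[4%N]/(2 * 2)%N exprM sqr_sqrtr ?ltW//.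
by under eq_fun do rewrite 3!big_cons big_seq1 mulrA.
Qed.

Let mean_le_self : mean_le P (fun w => @self_penalty R n' tau (a w)) (expR 1 * (2 * Num.sqrt tau)).
Proof.
apply: mean_leZ; first exact: expR_ge0.
by rewrite mulr_natl mulr2n; apply: mean_leD.
Qed.

(** Union bound over the n frequencies. *)
Lemma mean_le_single : mean_le P (fun w => @single_penalty R n' tau (a w))
  (expR 1 * (2 * Num.sqrt tau) + n%:R * (expR 1 * tau)).
Proof.
apply: mean_leD => //.
apply: (@mean_leW _ _ _ _ _ (\sum_(k : 'I_n | - k != k) (expR 1 * tau))).
  rewrite big_mkcond mulr_natl -[X in _ <= _ *+ X](card_ord n) -sumr_const.
  apply: ler_sum => k _; case: ifP => // _.
  by rewrite mulr_ge0 ?expR_ge0// ltW.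
apply: mean_le_sum => k kk; apply: mean_leZ; first exact: expR_ge0.
exact: mean_le_weight2.
Qed.

(** Two frequencies that are apart are weak together with probability O(tau ^ 2),
and the squared Gram entries sum to p n ^ 2. *)
Lemma mean_le_pair (eta : R) : 0 < eta -> mean_le P (fun w => @pair_penalty R p' n' tau eta (a w))
  (expR 1 * (2 * Num.sqrt tau) + expR 1 ^+ 2 * tau ^+ 2 * p%:R / eta ^+ 2).
Proof.
move=> eta0; apply: mean_leD => //.
have c0 : 0 <= expR 1 ^+ 2 * tau ^+ 2 :> R by rewrite mulr_ge0 ?sqr_ge0.
apply: (@mean_leW _ _ _ _ _ ((eta * n%:R) ^- 2 *
    \sum_(k : 'I_n) \sum_(l | apart k l) gram R p k l ^+ 2 * (expR 1 ^+ 2 * tau ^+ 2))).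
  rewrite ler_pdivrMl ?exprn_gt0 ?mulr_gt0//.
  rewrite [leRHS](_ : _ = (\sum_(k : 'I_n) \sum_(l : 'I_n) gram R p k l ^+ 2) *
      (expR 1 ^+ 2 * tau ^+ 2)); last first.
    rewrite sum_sqr_gram// exprMn; field.
    exact: lt0r_neq0.
  rewrite mulr_suml; apply: ler_sum => k _; rewrite mulr_suml [leLHS]big_mkcond.
  by apply: ler_sum => l _; case: ifP => // _; rewrite mulr_ge0 ?sqr_ge0.
apply: mean_leZ; first by rewrite invr_ge0 sqr_ge0.
apply: mean_le_sum => k _; apply: mean_le_sum => l kl.
apply: mean_leZ; first exact: sqr_ge0.
by apply: mean_leZ; [exact: sqr_ge0|exact: mean_le_weight4].
Qed.

(** Markov's inequality for the complementary event. *)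
Lemma probability_smallest_eigenvalue (theta t m : R) (V : T -> R) :
  theta < t -> mean_le P V m ->
  (forall w, V w < 1 -> forall v, t * normsq v <= form (@covariance_of R p' n' (a w)) v v) ->
  ((1 - m)%:E <=
    P [set w | (theta < smallest_eigenvalue (@covariance_of R p' n' (a w)))%R] <= 1)%E.
Proof.
move=> tt mV Vt.
set E := [set w | _].
have mE : measurable E.
  apply: measurable_smallest_eigenvalue_gt => [w|i j]; first exact: covariance_sym.
  rewrite /covariance_of /sample_covariance.
  under eq_fun do rewrite mxE mxE.
  apply: measurable_funM => //; apply: measurable_sum => k.
  by apply: measurable_funM; under eq_fun do rewrite ?mxE; exact: measurable_funP.
have PE : (P (~` E) <= m%:E)%E.
  apply: markov_event mV (measurableC mE) _ => w nE; rewrite leNgt; apply/negP => V1.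
  apply: nE; rewrite /E/=; apply: (lt_le_trans tt).
  by apply: (le_smallest_eigenvalue _ (covariance_sym _ _ _)).2; exact: Vt.
rewrite probability_le1// andbT.
move: PE; rewrite (probability_setC P mE).
rewrite -[P E]fineK ?fin_num_measure// -EFinB !lee_fin; lra.
Qed.

End Probability.

(** * Asymptotics *)

Section Bounds.
Context d (T : measurableType d) (R : realType) (P : probability T R).
Variable x : int -> {RV P >-> R}.
Hypothesis x_indep : mutually_independent x.
Hypothesis x_normal : forall i, standard_normal (x i).
Variables (p n : nat) (tau theta : R).
Hypotheses (p0 : (0 < p)%N) (pn : (p <= n)%N) (tau0 : 0 < tau).

Lemma smallest_eigenvalue_gt_single : theta < tau ->
  ((1 - (expR 1 * (2 * Num.sqrt tau) + n%:R * (expR 1 * tau)))%:E <=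
  P [set w | theta < smallest_eigenvalue
      (sample_covariance (@rect_circulant R p n (fun i => x i w)))]%R <= 1)%E.
Proof.
move=> tt; case: p p0 pn => // p' _; case: n => // n' pn'.
apply: (@probability_smallest_eigenvalue _ _ _ P x p' n' theta tau _ _ tt).
  exact: (@mean_le_single _ _ _ P x x_indep x_normal n' tau).
by move=> w sb v; exact: form_ge_single sb.
Qed.

Lemma smallest_eigenvalue_gt_pair (eta : R) : 0 < eta ->
  theta < tau * (1 - 2 * p%:R / n%:R - eta) ->
  ((1 - (expR 1 * (2 * Num.sqrt tau) + expR 1 ^+ 2 * tau ^+ 2 * p%:R / eta ^+ 2))%:E <=
  P [set w | theta < smallest_eigenvalue
      (sample_covariance (@rect_circulant R p n (fun i => x i w)))]%R <= 1)%E.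
Proof.
move=> eta0; case: p p0 pn => // p' _; case: n => // n' pn' tt.
apply: (@probability_smallest_eigenvalue _ _ _ P x p' n' theta _ _ _ tt).
  exact: (@mean_le_pair _ _ _ P x x_indep x_normal p' n' pn' tau tau0 eta eta0).
by move=> w sb v; exact: form_ge_pair sb.
Qed.
End Bounds.

Section Asymptotics.
Variable R : realType.

Lemma powRN_cvg0 (a : R) : 0 < a -> (p%:R : R) `^ (- a) @[p --> \oo] --> (0 : R).
Proof.
move=> a0; apply/cvgrPdist_lt => e e0; near=> p.
have p0 : 0 < (p%:R : R) by rewrite ltr0n; near: p; exact: nbhs_infty_gt.
rewrite sub0r normrN ger0_norm ?powR_ge0// powRN.
rewrite invf_plt ?posrE ?powR_gt0//.
have -> : e^-1 = (e^-1 `^ a^-1) `^ a.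
  by rewrite -powRrM mulVf ?gt_eqF// powRr1// invr_ge0 ltW.
rewrite gt0_ltr_powR ?nnegrE ?powR_ge0//.
near: p; exact: (nbhs_infty_gtr (e^-1 `^ a^-1)).
Unshelve. all: by end_near. Qed.

Lemma probability_cvg1 (f : nat -> \bar R) (m : nat -> R) : m p @[p --> \oo] --> (0 : R) ->
  (\forall p \near \oo, ((1 - m p)%:E <= f p <= 1)%E) -> f p @[p --> \oo] --> 1%E.
Proof.
move=> m0 mf; apply: (squeeze_cvge mf); last exact: cvg_cst.
apply: cvg_EFin; first exact: nearW.
by rewrite -[X in _ --> X]subr0; apply: cvgB => //; exact: cvg_cst.
Qed.

Lemma powR_sqrt (a r : R) : 0 < a -> Num.sqrt (a `^ r) = a `^ (r / 2).
Proof. by move=> a0; rewrite -powR12_sqrt ?powR_ge0// -powRrM. Qed.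
End Asymptotics.

Theorem theorem4 (d : measure_display) (T : measurableType d) (R : realType)
    (P : probability T R) (x : int -> {RV P >-> R})
    (x_indep : mutually_independent x)
    (x_normal : forall i : int, standard_normal (x i))
    (c : R) (c_gt0 : 0 < c) (c_le1 : c <= 1)
    (n : nat -> nat) (n_ge : forall p : nat, (p <= n p)%N)
    (n_lim : (p%:R / (n p)%:R : R) @[p --> \oo] --> c) :
  let lambda (p : nat) (w : T) : R :=
    smallest_eigenvalue
      (sample_covariance (@rect_circulant R p (n p) (fun i : int => x i w))) in
  (forall (m : nat) (delta : R), (2 <= m)%N -> 0 < delta -> delta < 1 ->
     c <= (1 - delta) / m%:R ->
     forall eps : R, 0 < eps ->
       P [set w | p%:R `^ (- (1 / 2) - 1 / (2 * m%:R) - eps) < lambda p w]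
         @[p --> \oo] --> 1%E) /\
  (1 / 2 <= c ->
     forall eps : R, 0 < eps ->
       P [set w | p%:R `^ (- 1 - eps) < lambda p w] @[p --> \oo] --> 1%E).
Proof.
move=> lambda; split.
- move=> m delta m2 delta0 delta1 cm eps eps0.
  pose tau (p : nat) : R := p%:R `^ (- (1 / 2 + eps / 2)).
  pose eta : R := delta / 4.
  have eta0 : 0 < eta by rewrite divr_gt0.
  apply: (@probability_cvg1 _ _ (fun p =>
    expR 1 * (2 * p%:R `^ (- (1 / 4 + eps / 4))) + expR 1 ^+ 2 / eta ^+ 2 * p%:R `^ (- eps))).
    rewrite -[X in _ --> X]addr0; apply: cvgD.
      rewrite -[X in _ --> X](mulr0 (expR 1)); apply: cvgM; first exact: cvg_cst.
      rewrite -[X in _ --> X](mulr0 2); apply: cvgM; first exact: cvg_cst.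
      by apply: powRN_cvg0; rewrite addr_gt0// divr_gt0.
    rewrite -[X in _ --> X](mulr0 (expR 1 ^+ 2 / eta ^+ 2)).
    by apply: cvgM; [exact: cvg_cst|exact: powRN_cvg0].
  have c2 : c <= (1 - delta) / 2.
    rewrite (le_trans cm)// ler_wpM2l ?subr_ge0 ?(ltW delta1)//.
    by rewrite lef_pV2 ?posrE ?ltr0n ?ler_nat// (leq_trans _ m2).
  near=> p.
  have p0 : (0 < p)%N by near: p; exact: nbhs_infty_gt.
  have pR0 : 0 < (p%:R : R) by rewrite ltr0n.
  have tau0 : 0 < tau p by exact: powR_gt0.
  have st : Num.sqrt (tau p) = p%:R `^ (- (1 / 4 + eps / 4)).
    by rewrite /tau powR_sqrt//; congr (_ `^ _); field.
  have t2 : tau p ^+ 2 * p%:R = p%:R `^ (- eps).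
    rewrite /tau -powR_mulrn ?powR_ge0// -powRrM -[X in _ * X](powRr1 (ltW pR0)) -powRD.
      by congr (_ `^ _); field.
    by rewrite (gt_eqF pR0) implybT.
  have ratio : p%:R / (n p)%:R < c + delta / 8.
    by near: p; apply: (cvgr_lt _ n_lim); rewrite ltrDl divr_gt0.
  have decay : p%:R `^ (- (1 / (2 * m%:R) + eps / 2)) < delta / 2.
    near: p; apply: (cvgr_lt _ (powRN_cvg0 _)); rewrite ?divr_gt0//.
    by rewrite addr_gt0 ?divr_gt0// mulr_gt0// ltr0n (leq_trans _ m2).
  have := @smallest_eigenvalue_gt_pair _ _ _ P x x_indep x_normal p (n p) (tau p)
    (p%:R `^ (- (1 / 2) - 1 / (2 * m%:R) - eps)) p0 (n_ge p) tau0 eta eta0.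
  have -> : expR 1 ^+ 2 * tau p ^+ 2 * p%:R / eta ^+ 2 =
      expR 1 ^+ 2 / eta ^+ 2 * p%:R `^ (- eps).
    by rewrite -t2; field; exact: lt0r_neq0.
  rewrite st; apply.
  have -> : (p%:R : R) `^ (- (1 / 2) - 1 / (2 * m%:R) - eps) =
      tau p * p%:R `^ (- (1 / (2 * m%:R) + eps / 2)).
    rewrite /tau -powRD; last by rewrite (gt_eqF pR0) implybT.
    congr (_ `^ _); have : m%:R != 0 :> R by rewrite pnatr_eq0 -lt0n (leq_trans _ m2).
    by move=> m0; field.
  (* c + delta/8 bounds p/n, so 2p/n + eta <= 1 - delta + delta/4 + delta/4. *)
  rewrite ltr_pM2l// (lt_le_trans decay)// -mulrA /eta.
  by move: ratio c2; lra.
- move=> _ eps eps0.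
  pose tau (p : nat) : R := p%:R `^ (- (1 + eps / 2)).
  apply: (@probability_cvg1 _ _ (fun p =>
    expR 1 * (2 * p%:R `^ (- (1 / 2 + eps / 4))) + 2 / c * expR 1 * p%:R `^ (- (eps / 2)))).
    rewrite -[X in _ --> X]addr0; apply: cvgD.
      rewrite -[X in _ --> X](mulr0 (expR 1)); apply: cvgM; first exact: cvg_cst.
      rewrite -[X in _ --> X](mulr0 2); apply: cvgM; first exact: cvg_cst.
      by apply: powRN_cvg0; rewrite addr_gt0// divr_gt0.
    rewrite -[X in _ --> X](mulr0 (2 / c * expR 1)).
    by apply: cvgM; [exact: cvg_cst|apply: powRN_cvg0; rewrite divr_gt0].
  near=> p.
  have p1 : (1 < p)%N by near: p; exact: nbhs_infty_gt.
  have p0 : (0 < p)%N by exact: ltnW.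
  have pR0 : 0 < (p%:R : R) by rewrite ltr0n.
  have tau0 : 0 < tau p by exact: powR_gt0.
  have nR0 : 0 < ((n p)%:R : R) by rewrite ltr0n (leq_trans p0).
  have st : Num.sqrt (tau p) = p%:R `^ (- (1 / 2 + eps / 4)).
    by rewrite /tau powR_sqrt//; congr (_ `^ _); field.
  have ratio : c / 2 < p%:R / (n p)%:R.
    by near: p; apply: (cvgr_gt _ n_lim); rewrite ltr_pdivrMr// mulr_natr mulr2n ltrDl.
  have ntau : (n p)%:R * tau p <= 2 / c * p%:R `^ (- (eps / 2)).
    have -> : tau p = p%:R^-1 * p%:R `^ (- (eps / 2)).
      rewrite /tau opprD powRD; last by rewrite (gt_eqF pR0) implybT.
      by rewrite powR_inv1// ltW.
    rewrite mulrA ler_wpM2r ?powR_ge0//.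
    rewrite ler_pdivrMr// mulrAC ler_pdivlMr// mulrC.
    by move: ratio; rewrite ltr_pdivlMr//; lra.
  have theta_tau : p%:R `^ (- 1 - eps) < tau p.
    rewrite /tau /powR gt_eqF// ltr_expR ltr_pM2r; last by rewrite ln_gt0// ltr1n.
    by lra.
  have /andP[h ->] := @smallest_eigenvalue_gt_single _ _ _ P x x_indep x_normal p (n p)
    (tau p) (p%:R `^ (- 1 - eps)) p0 (n_ge p) tau0 theta_tau.
  rewrite andbT; apply: le_trans h; rewrite lee_fin lerD2l lerN2 st lerD2l.
  rewrite mulrCA mulrAC [leRHS]mulrC ler_wpM2l ?expR_ge0//.
Unshelve. all: by end_near. Qed.
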